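(* Let $Z$ be a metric space, $d\ge1$, $l\ge0$ an integer, $\alpha>0$, and let $f:Z\times[0,1]^d\to\mathbb{R}$ be such that $f(\cdot,x)$ is continuous on $Z$ for each $x\in[0,1]^d$, $f(z,\cdot)$ is $l$ times continuously differentiable on $[0,1]^d$ for each $z\in Z$, and there is a constant $C_f>0$ independent of $z$ with \[ \Bigl|\frac{\partial^r f(z,x)}{\partial x_{s_1}\cdots\partial x_{s_r}}\Bigr|\le C_f,\quad x\in[0,1]^d, \] for all $0\le r\le l$, $s_1,\dots,s_r\in\{1,\dots,d\}$, and \[ \Bigl|\frac{\partial^l f(z,x^{(1)})}{\partial x_{s_1}\cdots\partial x_{s_l}}-\frac{\partial^l f(z,x^{(2)})}{\partial x_{s_1}\cdots\partial x_{s_l}}\Bigr|\le C_f|x^{(1)}-x^{(2)}|^\alpha \] for all $x^{(1)},x^{(2)}\in[0,1]^d$, $z\in Z$, $s_1,\dots,s_l\in\{1,\dots,d\}$. Let $\mu$ be a stochastic measure on the Borel subsets of $[0,1]^d$ and $\eta(z)=\int_{[0,1]^d}f(z,x)\,d\mu(x)$, $z\in Z$. If $l+\alpha>d/2$, then $\eta$ has the version \[ \tilde\eta(z)=\int_{[0,1]^d}S^{(d)}_1(f(z,\cdot),x)\,d\mu(x)+\sum_{k=1}^\infty\int_{[0,1]^d}\bigl(S^{(d)}_{2^k}(f(z,\cdot),x)-S^{(d)}_{2^{k-1}}(f(z,\cdot),x)\bigr)\,d\mu(x), \] and this version has continuous paths on $Z$ a.s.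
   Context: Let $(\Omega,\mathcal F,\mathsf P)$ be a complete probability space and $L_0$ the set of all real random variables on it, with convergence in probability. A stochastic measure (SM) on a measurable space $(X,\mathcal B)$ is a $\sigma$-additive map $\mu:\mathcal B\to L_0$ (finitely additive, and $\mu(A_n)\to0$ in probability whenever $A_n\downarrow\emptyset$). Every bounded measurable deterministic function $g$ is integrable w.r.t. $\mu$ (integral $\int g\,d\mu\in L_0$, with $\int\sum_ic_i\mathbf 1_{A_i}d\mu=\sum_ic_i\mu(A_i)$ for simple functions, and an analogue of the dominated convergence theorem in probability). In the series defining $\tilde\eta$ all integrands are simple functions, and a single fixed version of $\mu$ is used for all values of $\mu$ appearing. One-dimensional Haar functions on $[0,1]$: $\chi_1\equiv1$; for $n=2^j+i$, $1\le i\le2^j$, $j\ge0$, put $\Delta_n^+=((i-1)2^{-j},(2i-1)2^{-j-1})$, $\Delta_n^-=((2i-1)2^{-j-1},i2^{-j})$, $\chi_n=2^{j/2}$ on $\Delta_n^+$, $-2^{j/2}$ on $\Delta_n^-$, $0$ outside $[(i-1)2^{-j},i2^{-j}]$; at discontinuity points in $(0,1)$ $\chi_n$ equals the average of its one-sided limits, $\chi_n(0)=\chi_n(0+)$, $\chi_n(1)=\chi_n(1-)$. Multivariate Haar functions $\chi^{(d)}_{n_1,\dots,n_d}(x)=\prod_{s=1}^d\chi_{n_s}(x_s)$, coefficients $c^{(d)}_{n_1,\dots,n_d}(g)=\int_{[0,1]^d}g\,\chi^{(d)}_{n_1,\dots,n_d}\,dx$, partial sums $S^{(d)}_{2^k}(g,x)=\sum_{(n_1,\dots,n_d)\in\{1,\dots,2^k\}^d}c^{(d)}_{n_1,\dots,n_d}(g)\chi^{(d)}_{n_1,\dots,n_d}(x)$.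 *)

(* Defs.v *)
From HB Require Import structures.
From mathcomp Require Import all_boot all_order all_algebra.
From mathcomp Require Import all_classical all_reals all_analysis.
Set Implicit Arguments. Unset Strict Implicit. Unset Printing Implicit Defensive.
Import Order.TTheory GRing.Theory Num.Theory.
Import numFieldNormedType.Exports.
Local Open Scope classical_set_scope.
Local Open Scope ring_scope.

Section Defs.
Variable R : realType.

Definition pt (d : nat) := 'I_d -> R.

Definition in_cube {d} (x : pt d) : Prop := forall i, 0 <= x i <= 1.
Definition cube (d : nat) : set (pt d) := [set x | in_cube x].
Arguments cube d : clear implicits.

Definition eucl_dist {d} (x y : pt d) : R := Num.sqrt (\sum_(i < d) (x i - y i) ^+ 2).

Definition open_Rd {d} (O : set (pt d)) : Prop :=
  forall x, O x -> exists2 e : R, 0 < e & forall y, eucl_dist x y < e -> O y.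
Definition borel_cube (d : nat) : set (set (pt d)) :=
  <<s cube d, [set cube d `&` O | O in [set O : set (pt d) | open_Rd O]] >>.
Arguments borel_cube d : clear implicits.

Definition shift {d} (x : pt d) (s : 'I_d) (h : R) : pt d :=
  fun i => if i == s then x i + h else x i.

Definition partial_within {d} (g : pt d -> R) (s : 'I_d) (x : pt d) (v : R) : Prop :=
  (fun h => (g (shift x s h) - g x) / h) @
     within [set h | in_cube (shift x s h)] ((0 : R)^') --> v.

Definition cont_on_cube {d} (g : pt d -> R) : Prop :=
  forall x, in_cube x -> forall e : R, 0 < e -> exists2 del : R, 0 < del &
    forall y, in_cube y -> eucl_dist x y < del -> `|g y - g x| < e.

(** One-dimensional Haar functions (n >= 1); n = 2^j + i, 1 <= i <= 2^j. *)
Definition haar (n : nat) (x : R) : R :=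
  if (n <= 1)%N then 1 else
  let j := trunc_log 2 n.-1 in
  let i := (n - 2 ^ j)%N in
  let c := Num.sqrt 2 ^+ j in
  let a := i.-1%:R / (2 ^ j)%:R in
  let m := (2 * i).-1%:R / (2 ^ j.+1)%:R in
  let b := i%:R / (2 ^ j)%:R in
  if (a < x) && (x < m) then c
  else if (m < x) && (x < b) then - c
  else if x == m then 0
  else if x == a then (if a == 0 then c else c / 2)
  else if x == b then (if b == 1 then - c else - c / 2)
  else 0.

Definition haar_vals (n : nat) : seq R :=
  let c := Num.sqrt 2 ^+ trunc_log 2 n.-1 in [:: 1; c; - c; 0; c / 2; - c / 2].

Definition haar_d {d} (n : 'I_d -> nat) (x : pt d) : R :=
  \prod_(s < d) haar (n s) (x s).

Definition haar_d_vals {d} (n : 'I_d -> nat) : seq R :=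
  [seq \prod_(s < d) nth 0 (haar_vals (n s)) (t s) | t : {ffun 'I_d -> 'I_6}].

Definition setc {d} (x : pt d) (k : nat) (t : R) : pt d :=
  fun i => if val i == k then t else x i.
Fixpoint iint {d} (k : nat) (g : pt d -> R) : pt d -> R :=
  match k with
  | 0 => g
  | k'.+1 => fun x => \int[lebesgue_measure]_(t in `[0, 1]) iint k' g (setc x k' t)
  end.
Definition cube_integral {d} (g : pt d -> R) : R := iint d g (fun _ => 0).

Definition haar_coef {d} (n : 'I_d -> nat) (g : pt d -> R) : R :=
  cube_integral (fun x => g x * haar_d n x).

Definition haar_psum {d} (k : nat) (g : pt d -> R) (x : pt d) : R :=
  \sum_(t : {ffun 'I_d -> 'I_(2 ^ k)})
     haar_coef (fun s => (t s).+1) g * haar_d (fun s => (t s).+1) x.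

Variables (dO : measure_display) (Omega : measurableType dO).
Variable P : probability Omega R.

Definition conv_prob (X : nat -> Omega -> R) (Y : Omega -> R) : Prop :=
  forall e : R, 0 < e ->
    (fun n => P [set w | e <= `|X n w - Y w|]) @ \oo --> 0%E.

Definition stoch_measure {d} (mu : set (pt d) -> Omega -> R) : Prop :=
  [/\ forall A, borel_cube d A -> measurable_fun setT (mu A),
      forall A B, borel_cube d A -> borel_cube d B -> A `&` B = set0 ->
        {ae P, forall w, mu (A `|` B) w = mu A w + mu B w}
    & forall A : nat -> set (pt d), (forall n, borel_cube d (A n)) ->
        (forall n, A n.+1 `<=` A n) -> \bigcap_n A n = set0 ->
        conv_prob (fun n => mu (A n)) (fun _ => 0)].

Definition sint {d} (mu : set (pt d) -> Omega -> R) (vs : seq R) (h : pt d -> R)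
  : Omega -> R :=
  fun w => \sum_(v <- undup vs) v * mu (cube d `&` h @^-1` [set v]) w.

Definition simple_on_cube {d} (vs : seq R) (h : pt d -> R) : Prop :=
  (forall x, in_cube x -> h x \in vs) /\
  (forall v, borel_cube d (cube d `&` h @^-1` [set v])).

Definition stoch_integral {d} (mu : set (pt d) -> Omega -> R) (g : pt d -> R)
  (xi : Omega -> R) : Prop :=
  measurable_fun setT xi /\
  forall (vs : nat -> seq R) (h : nat -> pt d -> R),
    (forall m, simple_on_cube (vs m) (h m)) ->
    (forall e : R, 0 < e -> \forall m \near \oo,
        forall x, in_cube x -> `|h m x - g x| < e) ->
    conv_prob (fun m => sint mu (vs m) (h m)) xi.

Definition haar_int {d} (mu : set (pt d) -> Omega -> R) (n : 'I_d -> nat) : Omega -> R :=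
  sint mu (haar_d_vals n) (haar_d n).

(** ∫ S_{2^k}(g, x) dmu(x) = sum_n c_n(g) ∫ chi_n dmu *)
Definition int_haar_psum {d} (mu : set (pt d) -> Omega -> R) (k : nat) (g : pt d -> R)
  : Omega -> R :=
  fun w => \sum_(t : {ffun 'I_d -> 'I_(2 ^ k)})
     haar_coef (fun s => (t s).+1) g * haar_int mu (fun s => (t s).+1) w.

Definition eta_partial {d} (mu : set (pt d) -> Omega -> R) (g : pt d -> R) (K : nat)
  : Omega -> R :=
  fun w => int_haar_psum mu 0 g w +
    \sum_(1 <= k < K.+1) (int_haar_psum mu k g w - int_haar_psum mu k.-1 g w).

End Defs.

(* Main.v *)
(** Applying the definition of [stoch_integral] at a single [z] to two sequences of simple
    functions that both approximate [f z] uniformly shows that the integrals of simple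
    functions bounded by 1 are bounded in probability.  Randomizing signs (Paley-Zygmund), the
    random variables [lam_n * \int chi_n dmu] are then almost surely square summable whenever
    [\sum_n lam_n * |chi_n|] is bounded; [lam_n = \prod_s (rho / sqrt 2) ^ j_s] with [rho < 1]
    qualifies, where [j_s] is the dyadic level of [n_s].  On the other hand a Haar coefficient
    is an average of mixed differences of [f z] in any chosen set of coordinates; taking [l]
    derivatives and one Hoelder difference in suitably chosen coordinates gives
    [|c_n| <= Cf * \prod_s 2 ^ (- j_s / 2 - beta * j_s)] with [beta > 1/2] because
    [l + alpha > d / 2].  By Cauchy-Schwarz the series converges absolutely and uniformly in [z],
    its terms are continuous in [z], and its partial sums converge to [eta z] in probability
    since the Haar sums converge uniformly on the cube. *)
Require Import Defs.
From HB Require Import structures.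
From mathcomp Require Import all_boot all_order all_algebra.
From mathcomp Require Import all_classical all_reals all_analysis.
From mathcomp Require Import measurable_realfun ring lra zify.
Set Implicit Arguments. Unset Strict Implicit. Unset Printing Implicit Defensive.
Import Order.TTheory GRing.Theory Num.Theory.
Import numFieldNormedType.Exports.
Local Open Scope classical_set_scope.
Local Open Scope ring_scope.

(** * One-dimensional Haar functions *)

Section Haar1.
Variable R : realType.
Implicit Types (x y a b : R) (i j k n : nat).

(** The exceptional null set must serve all [z] at once, while additivity of [mu] holds almost
    surely only for a few sets at a time. So the randomness is confined to one statement without
    [z], the boundedness of the square sums of the weighted [haar_int mu n]; for a fixed [w] in that
    event the rest is deterministic. The threshold 1/2 for the exponent comes from counting. In each
    coordinate there are 2^j indices of level j, the squared quotient of coefficient bound and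
    weight is (theta / rho)^(2j) with theta = 2^(-beta), and the sum over levels converges when sqrt
    2 * theta < rho. Since the weights need rho < 1, there is room for rho exactly when beta > 1/2.
    The obstacle in the coefficient bound is that only l derivatives and one Hoelder increment are
    available in total, although all d levels may be large. Averaging over the cyclic rotations of
    the coordinates of positive level shows that, when there are more than l of them, some choice of
    l + 1 collects at least the share (l + alpha) / d of the sum of all levels. *)

Definition hat a b (l r : R) x : R :=
  ((a < x) && (x < b))%:R + l * (x == a)%:R + r * (x == b)%:R.

Lemma hat_split a (m : R) b l r x : a < m -> m < b ->
  hat a b l r x = hat a m l (1 / 2) x + hat m b (1 / 2) r x.
Proof.
move=> am mb; rewrite /hat.
by case: (ltgtP x a); case: (ltgtP x m); case: (ltgtP x b) => /=; lra.
Qed.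

Lemma hat_ge0 a b l r x : 0 <= l -> 0 <= r -> 0 <= hat a b l r x.
Proof. by move=> l0 r0; rewrite /hat; do 2?[apply: addr_ge0]; rewrite ?mulr_ge0. Qed.

Lemma hat_supp a b l r x : a < b -> hat a b l r x != 0 -> a <= x <= b.
Proof.
move=> ab; apply: contraNT; rewrite /hat.
by case: (ltgtP x a); case: (ltgtP x b) => //=; rewrite ?mulr0 ?addr0 //; lra.
Qed.

Definition dyad k i : R := i%:R / (2 ^ k)%:R.

Lemma dyad_double k i : dyad k.+1 i.*2 = dyad k i.
Proof.
rewrite /dyad expnS -mul2n !natrM; field.
by rewrite pnatr_eq0 -lt0n expn_gt0.
Qed.

Lemma ltr_dyad k i i' : (dyad k i < dyad k i') = (i < i')%N.
Proof. by rewrite /dyad ltr_pM2r ?ltr_nat // invr_gt0 ltr0n expn_gt0. Qed.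

Lemma dyadS k i : dyad k i.+1 = dyad k i + 2^-1 ^+ k.
Proof. by rewrite /dyad -addn1 natrD mulrDl mul1r natrX exprVn. Qed.

Lemma dyad_ge0 k i : 0 <= dyad k i. Proof. exact: divr_ge0. Qed.

Lemma dyad_le1 k i : (i <= 2 ^ k)%N -> dyad k i <= 1.
Proof. by move=> ik; rewrite /dyad ler_pdivrMr ?ltr0n ?expn_gt0// mul1r ler_nat. Qed.

(* Indicator of the [i]-th dyadic interval of level [k], with the value 1/2 at
   the endpoints inside (0,1), as prescribed for the Haar functions. *)
Definition dhat k i : R -> R :=
  hat (dyad k i) (dyad k i.+1) (if i == 0%N then 1 else 1 / 2)
      (if i.+1 == (2 ^ k)%N then 1 else 1 / 2).

Lemma dhat_split k i x : dhat k i x = dhat k.+1 i.*2 x + dhat k.+1 i.*2.+1 x.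
Proof.
rewrite /dhat -(@dyad_double k i) -(@dyad_double k i.+1) doubleS.
rewrite (@hat_split _ (dyad k.+1 i.*2.+1)) ?ltr_dyad // double_eq0 /=.
(* An odd number is not a positive power of 2, so the new endpoint is interior and has weight 1/2 on
   both sides. *)
have -> : (i.*2.+1 == (2 ^ k.+1)%N) = false.
  by apply/negP => /eqP /(congr1 odd); rewrite /= odd_double expnS mul2n odd_double.
by rewrite -doubleS expnS mul2n (inj_eq double_inj).
Qed.

Lemma dhat_ge0 k i x : 0 <= dhat k i x.
Proof. by apply: hat_ge0; case: ifP => _; lra. Qed.

Lemma dhat_supp k i x : dhat k i x != 0 -> dyad k i <= x <= dyad k i.+1.
Proof. by apply: hat_supp; rewrite ltr_dyad. Qed.

Lemma big_nat_shift (V : nmodType) (F : nat -> V) m n :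
  \sum_(m <= i < m + n) F i = \sum_(0 <= i < n) F (m + i)%N.
Proof.
rewrite -{1}[m]addn0 [in LHS]addnC big_addn addKn.
by apply: eq_bigr => i _; rewrite addnC.
Qed.

Lemma big_nat_double (V : nmodType) (F : nat -> V) n :
  \sum_(0 <= i < n.*2) F i = \sum_(0 <= i < n) (F i.*2 + F i.*2.+1).
Proof.
elim: n => [|n IH]; first by rewrite !big_nil.
by rewrite doubleS !big_nat_recr //= IH addrA.
Qed.

Lemma sum_dhat k x : 0 <= x <= 1 -> \sum_(0 <= i < 2 ^ k) dhat k i x = 1.
Proof.
move=> x01; elim: k => [|k IH].
  rewrite expn0 big_nat1 /dhat /hat /dyad /= expn0 !divr1.
  by move: x01; case: (ltgtP x 0); case: (ltgtP x 1) => /=; lra.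
rewrite -IH expnS mul2n big_nat_double.
by apply: eq_bigr => i _; rewrite -dhat_split.
Qed.

Lemma haar1 x : haar 1 x = 1. Proof. by []. Qed.

Lemma trunc_log2D j i : (i < 2 ^ j)%N -> trunc_log 2 (2 ^ j + i) = j.
Proof.
move=> ij; apply: trunc_log_eq => //.
by rewrite leq_addr /= expnS mul2n -addnn ltn_add2l.
Qed.

(** Here [i] counts from 0, so [(2 ^ j + i).+1] is the classical index 2^j + (i + 1). The endpoint
    weights of [dhat] reproduce the prescribed averages: 0 at the midpoint, half values at interior
    endpoints, full values at 0 and 1. *)
Lemma haar_dhat j i x : (i < 2 ^ j)%N ->
  haar (2 ^ j + i).+1 x =
  Num.sqrt 2 ^+ j * (dhat j.+1 i.*2 x - dhat j.+1 i.*2.+1 x).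
Proof.
move=> ij; rewrite /haar ltnS leqNgt addn_gt0 expn_gt0 /= trunc_log2D //.
rewrite subSn ?leq_addr // addKn mul2n doubleS !succnK.
rewrite -/(dyad j i) -/(dyad j i.+1) -/(dyad j.+1 i.*2.+1).
rewrite /dhat dyad_double -doubleS dyad_double double_eq0.
have -> : (i.*2.+1 == (2 ^ j.+1)%N) = false.
  by apply/negP => /eqP /(congr1 odd); rewrite /= odd_double expnS mul2n odd_double.
rewrite -?doubleS expnS mul2n (inj_eq double_inj).
have -> : (dyad j i == 0) = (i == 0)%N.
  by rewrite /dyad mulf_eq0 invr_eq0 !pnatr_eq0 expn_eq0 orbF.
have -> : (dyad j i.+1 == 1) = (i.+1 == 2 ^ j)%N.
  have N0 : (2 ^ j)%:R != 0 :> R by rewrite pnatr_eq0 -lt0n expn_gt0.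
  apply/eqP/eqP => [h|->]; last exact: divff.
  by apply/eqP; rewrite -(eqr_nat R) -[i.+1%:R](divfK N0) -/(dyad j i.+1) h mul1r.
have am : dyad j i < dyad j.+1 i.*2.+1 by rewrite -dyad_double ltr_dyad.
have mb : dyad j.+1 i.*2.+1 < dyad j i.+1 by rewrite -(dyad_double j i.+1) ltr_dyad doubleS.
move: (dyad j i) (dyad j.+1 i.*2.+1) (dyad j i.+1) am mb => a m b am mb.
rewrite /hat; set c := _ ^+ j.
by case: (ltgtP x a); case: (ltgtP x m); case: (ltgtP x b) => //=;
   case: ifP; case: ifP => *; lra.
Qed.

Lemma haarP (P : nat -> Prop) : P 1%N ->
  (forall j i, (i < 2 ^ j)%N -> P (2 ^ j + i).+1) -> forall n, (0 < n)%N -> P n.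
Proof.
move=> P1 Pj [//|[//|n]] _.
have /andP[l u] := trunc_log_bounds (isT : (1 < 2)%N) (isT : (0 < n.+1)%N).
rewrite -(subnKC l); apply: Pj.
by rewrite ltn_subLR // addnn -mul2n -expnS.
Qed.

(** The constant function (index 1) and the first oscillating one (index 2) both get level 0.
    Nothing is lost, since cancellation is exploited at positive levels only. *)
Definition lev n := trunc_log 2 n.-1.
Lemma lev1 : lev 1 = 0%N. Proof. by []. Qed.
Lemma levD j i : (i < 2 ^ j)%N -> lev (2 ^ j + i).+1 = j.
Proof. exact: trunc_log2D. Qed.

Lemma sqrt2_gt0 : 0 < Num.sqrt 2 :> R. Proof. by rewrite sqrtr_gt0. Qed.
Lemma sqrt2X j : Num.sqrt 2 ^+ j * Num.sqrt 2 ^+ j = 2 ^+ j :> R.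
Proof. by rewrite -exprMn -expr2 sqr_sqrtr. Qed.

(** The partial sums are conditional expectations on dyadic intervals. The induction step is the
    identity (a + b)(a' + b') + (a - b)(a' - b') = 2(aa' + bb'), with a, b the two halves of a
    dyadic interval at [x] and a', b' the same at [y]. *)
Lemma haar_kernel k x y :  0 <= x <= 1 -> 0 <= y <= 1 ->
  \sum_(0 <= n < 2 ^ k) haar n.+1 x * haar n.+1 y =
  2 ^+ k * \sum_(0 <= i < 2 ^ k) dhat k i x * dhat k i y.
Proof.
move=> x01 y01; elim: k => [|k IH].
  have b1 z : 0 <= z <= 1 -> dhat 0 0 z = 1.
    by move=> z01; rewrite -(sum_dhat 0 z01) expn0 big_nat1.
  by rewrite expn0 !big_nat1 !haar1 !b1 // !mulr1.
rewrite expnS mul2n -{1}addnn (@big_cat_nat _ _ _ (2 ^ k)) ?leq_addr // -[LHS]/(_ + _) {}IH.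
rewrite (@big_nat_shift _ _ (2 ^ k)) big_nat_double exprS -mulrA.
rewrite !mulr_sumr -big_split !big_nat; apply: eq_bigr => i /= ik.
rewrite !haar_dhat // (dhat_split k i x) (dhat_split k i y).
transitivity (2 ^+ k * ((dhat k.+1 i.*2 x + dhat k.+1 i.*2.+1 x) *
  (dhat k.+1 i.*2 y + dhat k.+1 i.*2.+1 y)) + Num.sqrt 2 ^+ k * Num.sqrt 2 ^+ k * ((dhat k.+1 i.*2 x - dhat k.+1 i.*2.+1 x) *
  (dhat k.+1 i.*2 y - dhat k.+1 i.*2.+1 y))); first by ring.
by rewrite sqrt2X; ring.
Qed.

Lemma normr_haar_dhat j i x : (i < 2 ^ j)%N ->
  `|haar (2 ^ j + i).+1 x| <= Num.sqrt 2 ^+ j * dhat j i x.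
Proof.
move=> ij; rewrite haar_dhat // normrM ger0_norm ?exprn_ge0 ?sqrtr_ge0 //.
rewrite ler_wpM2l ?exprn_ge0 ?sqrtr_ge0 // (dhat_split j i).
by rewrite (le_trans (ler_normB _ _)) // !ger0_norm ?dhat_ge0.
Qed.

Lemma sum_lev (F : nat -> R) k :
  \sum_(0 <= n < 2 ^ k) F n.+1 = F 1%N + \sum_(0 <= j < k) \sum_(0 <= i < 2 ^ j) F (2 ^ j + i).+1.
Proof.
elim: k => [|k IH]; first by rewrite expn0 big_nat1 big_nil addr0.
rewrite expnS mul2n -addnn (@big_cat_nat _ _ _ (2 ^ k)) ?leq_addr // -[LHS]/(_ + _) IH big_nat_recr // -addrA.
by rewrite (@big_nat_shift _ _ (2 ^ k)).
Qed.

Lemma sum_geom_le (r : R) k : 0 <= r < 1 -> \sum_(0 <= j < k) r ^+ j <= (1 - r)^-1.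
Proof.
move=> /andP[r0 r1]; rewrite big_mkord.
have := subrX1 r k => /(congr1 -%R); rewrite -mulNr !opprB => h.
rewrite -[leRHS]mulr1 ler_pdivlMl ?subr_gt0 // -h.
by rewrite lerBlDr lerDl exprn_ge0.
Qed.

Definition lam (rho : R) n := (Num.sqrt 2)^-1 ^+ lev n * rho ^+ lev n.

(** The factor (sqrt 2)^(-j) normalizes the Haar functions of level j, which are then dominated by
    the partition of unity [dhat j i]; level j contributes at most rho^j. *)
Lemma sum_lam_haar rho k x : 0 <= rho < 1 -> 0 <= x <= 1 ->
  \sum_(0 <= n < 2 ^ k) lam rho n.+1 * `|haar n.+1 x| <= 1 + (1 - rho)^-1.
Proof.
move=> rho01 x01; have /andP[r0 r1] := rho01.
rewrite (sum_lev (fun n => lam rho n * `|haar n x|)) haar1 normr1 /lam lev1 !expr0 !mulr1.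
rewrite lerD2l (le_trans _ (sum_geom_le k rho01)) //.
rewrite ler_sum // => j _; rewrite -[leRHS]mulr1 -[X in _ <= _ * X](sum_dhat j x01) mulr_sumr.
rewrite !big_nat ler_sum // => i /= ij; rewrite levD //.
have sj : Num.sqrt 2 ^+ j != 0 :> R by rewrite expf_neq0 // gt_eqF // sqrt2_gt0.
rewrite (le_trans (ler_wpM2l _ (normr_haar_dhat _ ij))) //.
  by rewrite mulr_ge0 ?exprn_ge0 ?invr_ge0 ?sqrtr_ge0.
by rewrite mulrACA exprVn mulVf // mul1r.
Qed.

End Haar1.

(** * Integrals over [0, 1] *)

Section Integral01.
Variable R : realType.
Implicit Types (t u v : R) (H w phi : R -> R).

Local Notation I01 := (`[(0 : R), 1]%classic).
Local Notation mu := (@lebesgue_measure R).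
Definition int01 phi : R := \int[mu]_(t in I01) phi t.

Definition cont01 H := forall t, 0 <= t <= 1 -> forall e : R, 0 < e ->
  exists2 del : R, 0 < del &
    forall t', 0 <= t' <= 1 -> `|t' - t| < del -> `|H t' - H t| < e.

(** Composition with this retraction turns continuity relative to [0,1] into continuity on the whole
    line. *)
Definition clamp t : R := Num.max 0 (Num.min t 1).

Lemma clamp01 t : 0 <= clamp t <= 1.
Proof. by rewrite /clamp le_max lexx /= ge_max ler01 /= ge_min lexx orbT. Qed.

Lemma clamp_id t : 0 <= t <= 1 -> clamp t = t.
Proof. by move=> /andP[t0 t1]; rewrite /clamp min_l // max_r. Qed.

Lemma clamp_lip t u : `|clamp t - clamp u| <= `|t - u|.
Proof.
rewrite /clamp ler_norml; case: (ger0P (t - u)) => tu; apply/andP;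
case: (leP t 1) => t1; case: (leP u 1) => u1; case: (leP (0 : R) 1) => o1;
case: (leP 0 t) => t0; case: (leP 0 u) => u0; split; lra.
Qed.

Lemma cont01_clamp H : cont01 H -> continuous (H \o clamp).
Proof.
move=> cH t; apply/cvgrPdist_lt => e e0.
have [del del0 hd] := cH _ (clamp01 t) _ e0.
apply/nbhs_ballP; exists del => // t' tt'; rewrite /= distrC.
apply: hd; first exact: clamp01.
by apply: le_lt_trans (clamp_lip _ _) _; rewrite distrC.
Qed.

Lemma in01 t : (t \in `[(0 : R), 1]) = (0 <= t <= 1). Proof. by rewrite in_itv. Qed.

Lemma cont01_within H : cont01 H -> {within I01, continuous H}.
Proof.
move=> cH; apply: (@subspace_eq_continuous _ _ _ (H \o clamp)).
  by move=> t; rewrite inE /= in01 => /clamp_id ->.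
by apply: continuous_subspaceT; exact: cont01_clamp.
Qed.

(** Boundedness, rather than mere integrability, makes the class closed under products, which the
    Haar weights require. *)
Definition mb01 phi := measurable_fun I01 phi /\
  exists M : R, forall t, 0 <= t <= 1 -> `|phi t| <= M.

Lemma cont01_mb H : cont01 H -> mb01 H.
Proof.
move=> cH; split.
  by apply: subspace_continuous_measurable_fun => //; exact: cont01_within.
have /compact_bounded[M [_ /(_ (M + 1))]] :
    compact (H @` I01) by apply: continuous_compact; [exact: cont01_within|exact: segment_compact].
move=> hM; exists (M + 1) => t t01; apply: hM; first by rewrite ltrDl.
by exists t => //=; rewrite in01.
Qed.

Lemma lebesgue_measure_cc (a b : R) : a < b -> mu `[a, b]%classic = (b - a)%:E.
Proof.
by move=> ab; have := lebesgue_measure_itv `[a, b] => /=; rewrite lte_fin ab EFinB.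
Qed.

Lemma lebesgue_measure_oo (a b : R) : a < b -> mu `]a, b[%classic = (b - a)%:E.
Proof.
by move=> ab; have := lebesgue_measure_itv `]a, b[ => /=; rewrite lte_fin ab EFinB.
Qed.

Lemma mb01_integrable phi : mb01 phi -> mu.-integrable I01 (EFin \o phi).
Proof.
move=> [mphi [M hM]]; apply: measurable_bounded_integrable => //.
  by rewrite [X in (X < _)%E](lebesgue_measure_cc ltr01) ltry.
exists M; split; first exact: num_real.
by move=> x Mx t /=; rewrite in01 => /hM/le_trans; apply; exact: ltW.
Qed.

Lemma mb01D phi psi : mb01 phi -> mb01 psi -> mb01 (fun t => phi t + psi t).
Proof.
move=> [m1 [M1 h1]] [m2 [M2 h2]]; split; first exact: measurable_funD.
by exists (M1 + M2) => t t01; rewrite (le_trans (ler_normD _ _)) // lerD ?h1 ?h2.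
Qed.

Lemma mb01M phi psi : mb01 phi -> mb01 psi -> mb01 (fun t => phi t * psi t).
Proof.
move=> [m1 [M1 h1]] [m2 [M2 h2]]; split; first exact: measurable_funM.
by exists (M1 * M2) => t t01; rewrite normrM ler_pM ?h1 ?h2.
Qed.

Lemma mb01_cst c : mb01 (fun=> c).
Proof. by split; [exact: measurable_cst|exists `|c|]. Qed.

Lemma mb01Z c phi : mb01 phi -> mb01 (fun t => c * phi t).
Proof. exact/mb01M/mb01_cst. Qed.

Lemma mb01B phi psi : mb01 phi -> mb01 psi -> mb01 (fun t => phi t - psi t).
Proof.
move=> h1 /(mb01Z (-1)) /(mb01D h1).
by under eq_fun do rewrite mulN1r.
Qed.

Lemma mb01_norm phi : mb01 phi -> mb01 (fun t => `|phi t|).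
Proof.
move=> [m1 [M1 h1]]; split; first exact: measurableT_comp.
by exists M1 => t t01; rewrite normr_id h1.
Qed.

Lemma mb01_indic (A : set R) : measurable A -> mb01 (\1_A).
Proof.
move=> mA; split; first exact: measurable_indic.
by exists 1 => t _; rewrite indicE; case: (_ \in _); rewrite ?normr1 ?normr0.
Qed.

Lemma int01D phi psi : mb01 phi -> mb01 psi ->
  int01 (fun t => phi t + psi t) = int01 phi + int01 psi.
Proof. by move=> h1 h2; apply: RintegralD => //; exact: mb01_integrable. Qed.

Lemma int01B phi psi : mb01 phi -> mb01 psi ->
  int01 (fun t => phi t - psi t) = int01 phi - int01 psi.
Proof. by move=> h1 h2; apply: RintegralB => //; exact: mb01_integrable. Qed.

Lemma int01Z c phi : mb01 phi -> int01 (fun t => c * phi t) = c * int01 phi.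
Proof. by move=> h1; apply: RintegralZl => //; exact: mb01_integrable. Qed.

Lemma int01_le phi psi : mb01 phi -> mb01 psi ->
  (forall t, 0 <= t <= 1 -> phi t <= psi t) -> int01 phi <= int01 psi.
Proof.
move=> h1 h2 h; apply: le_Rintegral => //; exact: mb01_integrable.
Qed.

Lemma int01_eq phi psi : (forall t, 0 <= t <= 1 -> phi t = psi t) ->
  int01 phi = int01 psi.
Proof. by move=> h; apply: eq_Rintegral => t; rewrite inE /= in01 => /h. Qed.

Lemma int01_norm phi : mb01 phi -> `|int01 phi| <= int01 (fun t => `|phi t|).
Proof. by move=> h; apply: le_normr_Rintegral => //; exact: mb01_integrable. Qed.

Lemma int01_cst c : int01 (fun=> c) = c.
Proof.
by rewrite /int01 Rintegral_cst // [X in fine X](lebesgue_measure_cc ltr01) /= subr0 mulr1.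
Qed.

Lemma int01_indic (A : set R) : measurable A -> int01 (\1_A) = fine (mu (A `&` I01)).
Proof. by move=> mA; rewrite /int01 /Rintegral integral_indic. Qed.

Lemma int01_norm_le phi M : mb01 phi -> (forall t, 0 <= t <= 1 -> `|phi t| <= M) ->
  `|int01 phi| <= M.
Proof.
move=> h hM; rewrite (le_trans (int01_norm h)) // -[leRHS]int01_cst.
by apply: int01_le => //; [exact: mb01_norm|exact: mb01_cst].
Qed.

Lemma int01_mean H w c M : mb01 H -> mb01 w -> (forall t, 0 <= w t) ->
  (forall t, 0 <= t <= 1 -> w t != 0 -> `|H t - c| <= M) ->
  `|int01 (fun t => H t * w t) - c * int01 w| <= M * int01 w.
Proof.
move=> mH mw w0 hM; rewrite -int01Z // -int01B; [|exact: mb01M|exact: mb01Z].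
have mHc : mb01 (fun t => H t * w t - c * w t) by apply: mb01B; [exact: mb01M|exact: mb01Z].
rewrite (le_trans (int01_norm mHc)) // -int01Z // int01_le //.
- exact: mb01_norm.
- exact: mb01Z.
move=> t t01; rewrite -mulrBl normrM [X in _ * X]ger0_norm //.
by have [->|/(hM _ t01)] := eqVneq (w t) 0; [rewrite !mulr0|move/ler_wpM2r; exact].
Qed.

Lemma hat_indic a b l r : hat a b l r =
  (fun t => (\1_`]a, b[%classic t + l * \1_[set a] t) + r * \1_[set b] t).
Proof.
apply/funext => t; rewrite /hat !indicE.
have -> : (t \in [set` `]a, b[]) = (a < t) && (t < b) by rewrite mem_setE in_itv.
have s1 (x : R) : (t \in [set x]) = (t == x).
  by apply/idP/eqP => [|->]; rewrite inE.
by rewrite !s1.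
Qed.

Lemma mb01_hat a b l r : mb01 (hat a b l r).
Proof.
rewrite hat_indic; apply: mb01D; last by apply/mb01Z/mb01_indic; exact: measurable_set1.
by apply: mb01D; [exact: mb01_indic|apply/mb01Z/mb01_indic; exact: measurable_set1].
Qed.

Lemma int01_hat a b l r : 0 <= a -> a < b -> b <= 1 -> int01 (hat a b l r) = b - a.
Proof.
move=> a0 ab b1; rewrite hat_indic.
have mI : mb01 (\1_`]a, b[%classic : R -> R) by exact: mb01_indic.
have m1 x : mb01 (\1_[set x] : R -> R) by exact: mb01_indic.
have z x : int01 (\1_[set x]) = 0.
  rewrite int01_indic //; suff -> : (mu ([set x] `&` I01) = 0)%E by [].
  apply/eqP; rewrite -measure_le0 -(lebesgue_measure_set1 x) le_measure ?inE //.
  exact: measurableI.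
rewrite int01D; [|by apply: mb01D => //; exact: mb01Z|exact: mb01Z].
rewrite int01D //; [|exact: mb01Z].
rewrite !int01Z // !z !mulr0 !addr0 int01_indic //.
rewrite setIidl; first by rewrite [X in fine X](lebesgue_measure_oo ab).
by move=> t /=; rewrite !in_itv /= => /andP[? ?]; apply/andP; split; lra.
Qed.

Lemma mb01_dhat k i : mb01 (dhat k i : R -> R). Proof. exact: mb01_hat. Qed.

Lemma int01_dhat k i : (i < 2 ^ k)%N -> int01 (dhat k i) = 2^-1 ^+ k.
Proof.
move=> ik; rewrite int01_hat ?dyad_ge0 ?ltr_dyad ?dyad_le1 //.
by rewrite dyadS addrC addKr.
Qed.

Lemma mb01_haar n : (0 < n)%N -> mb01 (haar n : R -> R).
Proof.
move: n; apply: haarP => [|j i ij].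
  by rewrite (_ : haar 1 = fun=> 1) //; exact: mb01_cst.
rewrite (funext (fun t => haar_dhat t ij)); apply: mb01Z.
by apply: mb01B; exact: mb01_dhat.
Qed.

Lemma int01_haar n : (0 < n)%N -> int01 (haar n) = (n == 1%N)%:R :> R.
Proof.
move: n; apply: haarP => [|j i ij].
  by rewrite (_ : haar 1 = fun=> 1) // int01_cst.
rewrite (funext (fun t => haar_dhat t ij)) int01Z; last by apply: mb01B; exact: mb01_dhat.
rewrite int01B; try exact: mb01_dhat.
have ij2 : (i.*2.+1 < 2 ^ j.+1)%N.
  by rewrite expnS mul2n -doubleS leq_double.
rewrite !int01_dhat // ?(ltn_trans _ ij2) // subrr mulr0.
by rewrite eqSS addn_eq0 expn_eq0.
Qed.

Lemma sqrt2Vhalf j : Num.sqrt 2 ^+ j * 2^-1 ^+ j = (Num.sqrt 2)^-1 ^+ j :> R.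
Proof.
have sj : Num.sqrt 2 ^+ j != 0 :> R by rewrite expf_neq0 // gt_eqF // sqrt2_gt0.
by rewrite !exprVn -sqrt2X invfM mulrA mulfV // mul1r.
Qed.

(** Height 2^(j/2) times length 2^(-j) of the support. *)
Lemma haar_integral_le n H M : (0 < n)%N -> mb01 H ->
  (forall t, 0 <= t <= 1 -> `|H t| <= M) ->
  `|int01 (fun t => H t * haar n t)| <= M * (Num.sqrt 2)^-1 ^+ lev n.
Proof.
move=> n0 mH hM; have M0 : 0 <= M.
  by apply: le_trans (hM 0 _); rewrite ?normr_ge0 ?lexx ?ler01.
move: n n0; apply: haarP => [|j i ij].
  rewrite expr0 mulr1; apply: int01_norm_le.
    by apply: mb01M => //; exact: mb01_haar.
  by move=> t t01; rewrite mulr1 hM.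
rewrite levD // -sqrt2Vhalf -(int01_dhat ij) mulrA -int01Z; last exact: mb01_dhat.
have mHh : mb01 (fun t => H t * haar (2 ^ j + i).+1 t).
  by apply: mb01M => //; exact: mb01_haar.
rewrite (le_trans (int01_norm mHh)) // int01_le //.
- exact: mb01_norm.
- by apply: mb01Z; exact: mb01_dhat.
by move=> t t01; rewrite normrM -mulrA ler_pM // ?hM // normr_haar_dhat.
Qed.

(** The integral compares [H] on the two halves of the support. [int01_mean] is used twice: on the
    left half it compares the mean [A] of [H] with each value on the right half, and on the right
    half it compares the integral of [H] with [A] times the length. *)
Lemma haar_integral_osc n H M : (0 < lev n)%N -> mb01 H ->
  (forall u v, 0 <= u <= 1 -> 0 <= v <= 1 -> `|u - v| <= 2^-1 ^+ lev n ->
    `|H u - H v| <= M) ->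
  `|int01 (fun t => H t * haar n t)| <= M * (Num.sqrt 2)^-1 ^+ lev n.
Proof.
move=> ln mH hM; have n0 : (0 < n)%N by case: n ln hM.
have M0 : 0 <= M.
  by apply: le_trans (hM 0 0 _ _ _); rewrite ?subrr ?normr0 ?lexx ?ler01 ?exprn_ge0 ?invr_ge0.
move: n n0 ln hM; apply: haarP => [//|j i ij]; rewrite levD // => j0 hM.
have ij2 : (i.*2.+1 < 2 ^ j.+1)%N.
  by rewrite expnS mul2n -doubleS leq_double.
set b1 := dhat j.+1 i.*2 : R -> R; set b2 := dhat j.+1 i.*2.+1 : R -> R.
have mb1 : mb01 b1 by exact: mb01_dhat.
have mb2 : mb01 b2 by exact: mb01_dhat.
set h : R := 2^-1 ^+ j.+1; have h0 : 0 < h by rewrite exprn_gt0 // invr_gt0.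
have Ib1 : int01 b1 = h by rewrite int01_dhat // (ltn_trans _ ij2).
have Ib2 : int01 b2 = h by rewrite int01_dhat.
have supp t : b1 t != 0 \/ b2 t != 0 -> dyad R j i <= t <= dyad R j i.+1.
  move=> bt; apply: dhat_supp; rewrite dhat_split.
  have := dhat_ge0 j.+1 i.*2 t; have := dhat_ge0 j.+1 i.*2.+1 t.
  rewrite -/(b1 t) -/(b2 t) => p2 p1; rewrite gt_eqF //.
  by case: bt => /negbTE bt; [apply: ltr_wpDr => //|apply: ltr_wpDl => //]; rewrite lt0r bt.
have osc u v : 0 <= u <= 1 -> 0 <= v <= 1 -> b1 u != 0 -> b2 v != 0 -> `|H u - H v| <= M.
  move=> u01 v01 bu bv; apply: hM => //.
  have := supp u (or_introl bu); have := supp v (or_intror bv); rewrite dyadS.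
  by move=> /andP[? ?] /andP[? ?]; rewrite ler_norml; apply/andP; split; lra.
set A := int01 (fun t => H t * b1 t) / h.
have hA v : 0 <= v <= 1 -> b2 v != 0 -> `|H v - A| <= M.
  move=> v01 bv; rewrite distrC -(ler_pM2r h0) -{1}[h]gtr0_norm // -normrM mulrBl.
  rewrite divfK ?gt_eqF // -Ib1; apply: int01_mean => //; first by move=> t; exact: dhat_ge0.
  by move=> u u01 bu; exact: osc.
have := int01_mean mH mb2 (dhat_ge0 _ _) hA.
rewrite Ib2 divfK ?gt_eqF // => hD.
rewrite (_ : int01 _ = Num.sqrt 2 ^+ j *
  (int01 (fun t => H t * b1 t) - int01 (fun t => H t * b2 t))); last first.
  rewrite -int01B; try exact: mb01M; rewrite -int01Z.
    by apply: int01_eq => t _; rewrite haar_dhat // mulrCA mulrBr.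
  by apply: mb01B; exact: mb01M.
rewrite normrM distrC ger0_norm ?exprn_ge0 ?sqrtr_ge0 // -sqrt2Vhalf [M * _]mulrCA.
rewrite ler_wpM2l ?exprn_ge0 ?sqrtr_ge0 // (le_trans hD) // ler_wpM2l //.
by rewrite /h exprS ler_piMl ?exprn_ge0 ?invr_ge0 // invf_le1 // ler1n.
Qed.

End Integral01.

(** * Iterated integrals and uniform convergence of Haar sums *)

Section CubeIntegral.
Variables (R : realType) (d : nat).
Implicit Types (x y : pt R d) (g G H : pt R d -> R) (w : nat -> R -> R) (k : nat) (t u : R).

Lemma setc_cube x k t : in_cube x -> 0 <= t <= 1 -> in_cube (setc x k t).
Proof. by move=> xc t01 i; rewrite /setc; case: ifP. Qed.

Lemma setcC x k k' t u : k != k' -> setc (setc x k t) k' u = setc (setc x k' u) k t.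
Proof.
move=> kk'; apply/funext => i; rewrite /setc.
by case: eqP => [->|//]; rewrite eq_sym (negbTE kk').
Qed.

(** The sup distance suits arguments that treat one coordinate at a time, and the weak inequality is
    what survives integration. *)
Definition unif_cont g := forall e : R, 0 < e -> exists2 del : R, 0 < del &
  forall x y, in_cube x -> in_cube y -> (forall i, `|x i - y i| < del) ->
    `|g x - g y| <= e.

Lemma unif_cont_setc g x k : unif_cont g -> in_cube x ->
  cont01 (fun t => g (setc x k t)).
Proof.
move=> ug xc t t01 e e0.
have e20 : 0 < e / 2 by rewrite divr_gt0.
have [del del0 hd] := ug _ e20; exists del => // t' t'01 tt'.
apply: le_lt_trans (_ : e / 2 < e); last by rewrite ltr_pdivrMr // ltr_pMr // ltr1n.
apply: hd; [exact: setc_cube|exact: setc_cube|move=> i].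
by rewrite /setc; case: ifP => // _; rewrite subrr normr0.
Qed.

(** Each weight enters together with the integration over its own coordinate. The intermediate
    stages thus stay uniformly continuous in the remaining coordinates, unlike those of [iint]
    applied to a product with discontinuous Haar factors. *)
Fixpoint wint w k g : pt R d -> R :=
  if k is k'.+1 then fun x => int01 (fun t => wint w k' g (setc x k' t) * w k' t) else g.

Lemma unif_cont_wint w k g : (forall k, mb01 (w k)) -> unif_cont g ->
  unif_cont (wint w k g).
Proof.
move=> mw ug; elim: k => [//|k IH] /= e e0.
have [_ [M hM]] := mw k.
have M10 : 0 < M + 1.
  by have := hM 0; rewrite lexx ler01 => /(_ isT) /(le_trans (normr_ge0 _)); lra.
have [del del0 hd] := IH (e / (M + 1)) (divr_gt0 e0 M10); exists del => // x y xc yc xy.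
have mF z : in_cube z -> mb01 (fun t => wint w k g (setc z k t)).
  by move=> zc; apply: cont01_mb; exact: unif_cont_setc.
rewrite -int01B; try by apply: mb01M => //; exact: mF.
apply: int01_norm_le; first by apply: mb01B; apply: mb01M => //; exact: mF.
move=> t t01; rewrite -mulrBl normrM -[e](divfK (lt0r_neq0 M10)) ler_pM //.
  apply: hd; [exact: setc_cube|exact: setc_cube|move=> i].
  by rewrite /setc; case: ifP => // _; rewrite subrr normr0.
by rewrite (le_trans (hM _ t01)) // lerDl.
Qed.

Lemma mb01_wint w k g x k' : (forall k, mb01 (w k)) -> unif_cont g -> in_cube x ->
  mb01 (fun t => wint w k g (setc x k' t)).
Proof.
by move=> mw ug xc; apply: cont01_mb; apply: unif_cont_setc => //; exact: unif_cont_wint.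
Qed.

Definition tensor w g x : R := g x * \prod_(i < d) w i (x i).

Lemma iint_tensor w g k x : (forall k, mb01 (w k)) -> unif_cont g ->
  (k <= d)%N -> in_cube x ->
  iint k (tensor w g) x = wint w k g x * \prod_(i < d | (k <= i)%N) w i (x i).
Proof.
move=> mw ug; elim: k x => [//|k IH] x kd xc /=.
rewrite mulrC -int01Z; last by apply: mb01M => //; exact: mb01_wint.
apply: int01_eq => t t01; rewrite IH ?(ltnW kd) //; last exact: setc_cube.
rewrite (bigD1 (Ordinal kd)) //= /setc eqxx -/(setc x k t) [RHS]mulrC -mulrA; congr (_ * (_ * _)).
apply: eq_big => [i|i /andP[_ ik]].
  by rewrite ltn_neqAle eq_sym andbC.
by rewrite ifN.
Qed.

(** Linearity and monotonicity of an iterated integral need an integrable section at every stage,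
    not only at the first. *)
Definition iint_ok G := forall k x, (k < d)%N -> in_cube x ->
  mb01 (fun t => iint k G (setc x k t)).

Lemma mb01_eq (phi psi : R -> R) : (forall t, 0 <= t <= 1 -> phi t = psi t) ->
  mb01 psi -> mb01 phi.
Proof.
move=> e [m [M hM]]; split; last by exists M => t t01; rewrite e ?hM.
by apply: eq_measurable_fun m => t; rewrite inE /= in01 => /e.
Qed.

Lemma iint_ok_tensor w g : (forall k, mb01 (w k)) -> unif_cont g -> iint_ok (tensor w g).
Proof.
move=> mw ug k x kd xc; set c := \prod_(i < d | (k < i)%N) w i (x i).
apply: (@mb01_eq _ (fun t => c * (wint w k g (setc x k t) * w k t))).
  move=> t t01; rewrite iint_tensor ?(ltnW kd) //; last exact: setc_cube.
  rewrite (bigD1 (Ordinal kd)) //= /setc eqxx -/(setc x k t) [RHS]mulrC -mulrA; congr (_ * (_ * _)).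
  apply: eq_big => [i|i /andP[_ ik]].
    by rewrite ltn_neqAle eq_sym andbC.
  by rewrite ifN.
by apply/mb01Z/mb01M => //; exact: mb01_wint.
Qed.

Lemma iint_eq G H k x : (forall x, in_cube x -> G x = H x) -> in_cube x ->
  iint k G x = iint k H x.
Proof.
move=> e; elim: k x => [|k IH] x xc /=; first exact: e.
by apply: int01_eq => t t01; apply: IH; exact: setc_cube.
Qed.

Lemma iintD G H k x : iint_ok G -> iint_ok H -> (k <= d)%N -> in_cube x ->
  iint k (fun x => G x + H x) x = iint k G x + iint k H x.
Proof.
move=> oG oH; elim: k x => [//|k IH] x kd xc /=.
rewrite -[RHS]int01D; [|exact: oG|exact: oH].
by apply: int01_eq => t t01; rewrite IH ?(ltnW kd) //; exact: setc_cube.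
Qed.

Lemma iintZ c G k x : iint_ok G -> (k <= d)%N -> in_cube x ->
  iint k (fun x => c * G x) x = c * iint k G x.
Proof.
move=> oG; elim: k x => [//|k IH] x kd xc /=.
rewrite -[RHS]int01Z; last exact: oG.
by apply: int01_eq => t t01; rewrite IH ?(ltnW kd) //; exact: setc_cube.
Qed.

Lemma iint_okD G H : iint_ok G -> iint_ok H -> iint_ok (fun x => G x + H x).
Proof.
move=> oG oH k x kd xc; apply: mb01_eq (mb01D (oG k x kd xc) (oH k x kd xc)).
by move=> t t01; rewrite iintD ?(ltnW kd) //; exact: setc_cube.
Qed.

Lemma iint_okZ c G : iint_ok G -> iint_ok (fun x => c * G x).
Proof.
move=> oG k x kd xc; apply: mb01_eq (mb01Z c (oG k x kd xc)).
by move=> t t01; rewrite iintZ ?(ltnW kd) //; exact: setc_cube.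
Qed.

Lemma iint_le G H k x : iint_ok G -> iint_ok H ->
  (forall x, in_cube x -> G x <= H x) -> (k <= d)%N -> in_cube x ->
  iint k G x <= iint k H x.
Proof.
move=> oG oH GH; elim: k x => [|k IH] x kd xc /=; first exact: GH.
apply: int01_le; [exact: oG|exact: oH|move=> t t01].
by apply: IH; [exact: ltnW|exact: setc_cube].
Qed.

Lemma cube0 : in_cube ((fun _ => 0) : pt R d).
Proof. by move=> i; rewrite lexx ler01. Qed.

Lemma cube_integral_eq G H : (forall x, in_cube x -> G x = H x) ->
  cube_integral G = cube_integral H :> R.
Proof. by move=> e; apply: iint_eq => //; exact: cube0. Qed.

Lemma cube_integral_le G H : iint_ok G -> iint_ok H ->
  (forall x, in_cube x -> G x <= H x) -> cube_integral G <= cube_integral H :> R.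
Proof. by move=> oG oH GH; apply: iint_le => //; exact: cube0. Qed.

Lemma cube_integralD G H : iint_ok G -> iint_ok H ->
  cube_integral (fun x => G x + H x) = cube_integral G + cube_integral H :> R.
Proof. by move=> oG oH; apply: iintD => //; exact: cube0. Qed.

Lemma cube_integralZ c G : iint_ok G ->
  cube_integral (fun x => c * G x) = c * cube_integral G :> R.
Proof. by move=> oG; apply: iintZ => //; exact: cube0. Qed.

Lemma cube_integral_norm G H : iint_ok G -> iint_ok H ->
  (forall x, in_cube x -> `|G x| <= H x) -> `|cube_integral G| <= cube_integral H :> R.
Proof.
move=> oG oH GH; rewrite ler_norml -mulN1r -cube_integralZ //; apply/andP; split.
  apply: cube_integral_le => //; first exact: iint_okZ.
  by move=> x /GH; rewrite ler_norml mulN1r => /andP[].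
by apply: cube_integral_le => // x /GH; rewrite ler_norml => /andP[].
Qed.

Lemma unif_cont_cst (c : R) : unif_cont (fun=> c).
Proof. by move=> e e0; exists 1 => // *; rewrite subrr normr0 ltW. Qed.

Lemma iint_ok0 : iint_ok (fun=> 0).
Proof.
have := iint_okZ 0 (iint_ok_tensor (fun k => @mb01_cst R 1) (unif_cont_cst 0)).
by under eq_fun do rewrite mul0r.
Qed.

Lemma cube_integral_sum (T : Type) (s : seq T) (G : T -> pt R d -> R) :
  (forall i, iint_ok (G i)) ->
  iint_ok (fun x => \sum_(i <- s) G i x) /\
  cube_integral (fun x => \sum_(i <- s) G i x) = \sum_(i <- s) cube_integral (G i) :> R.
Proof.
move=> oG; elim: s => [|i s [oS IH]].
  rewrite big_nil (_ : (fun x => _) = fun=> 0); last by apply/funext => x; rewrite big_nil.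
  split; first exact: iint_ok0.
  have := cube_integralZ 0 iint_ok0; rewrite [RHS]mul0r => z; rewrite -[RHS]z.
  by apply: cube_integral_eq => x _; rewrite mul0r.
rewrite big_cons -IH -cube_integralD // (_ : (fun x => _) = fun x => G i x + \sum_(i <- s) G i x).
  by split=> //; exact: iint_okD.
by apply/funext => x; rewrite big_cons.
Qed.

Lemma cube_integral_tensor w g : (forall k, mb01 (w k)) -> unif_cont g ->
  cube_integral (tensor w g) = wint w d g (fun=> 0) :> R.
Proof.
move=> mw ug; rewrite /cube_integral iint_tensor //; last exact: cube0.
by rewrite big_pred0 ?mulr1 // => i; rewrite leqNgt ltn_ord.
Qed.

Lemma wint_cst w k (c : R) x : (forall k, mb01 (w k)) -> (forall k, int01 (w k) = 1) ->
  wint w k (fun=> c) x = c.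
Proof.
move=> mw w1; elim: k x => [//|k IH] x /=.
rewrite -[RHS]mulr1 -(w1 k) -int01Z //.
by apply: int01_eq => t _; rewrite IH.
Qed.

(* Junk value [a] at indices [k >= d]. *)
Definition extend (T : Type) (a : T) (v : 'I_d -> T) k : T :=
  if insub k is Some i then v i else a.

Lemma extendE (T : Type) (a : T) (v : 'I_d -> T) (i : 'I_d) : extend a v i = v i.
Proof. by rewrite /extend valK. Qed.

Definition haar_w (n : 'I_d -> nat) k : R -> R := haar (extend 1%N n k).

Lemma extend_gt0 (n : 'I_d -> nat) k : (forall i, 0 < n i)%N -> (0 < extend 1%N n k)%N.
Proof. by move=> n0; rewrite /extend; case: insub. Qed.

Lemma mb01_haar_w n k : (forall i, 0 < n i)%N -> mb01 (haar_w n k).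
Proof. by move=> n0; apply: mb01_haar; exact: extend_gt0. Qed.

Lemma tensor_haar n g : (fun x => g x * haar_d n x) = tensor (haar_w n) g.
Proof.
apply/funext => x; congr (_ * _); apply: eq_bigr => i _.
by rewrite /haar_w extendE.
Qed.

Lemma haar_coef_wint n g : (forall i, 0 < n i)%N -> unif_cont g ->
  haar_coef n g = wint (haar_w n) d g (fun=> 0).
Proof.
move=> n0 ug; rewrite /haar_coef tensor_haar cube_integral_tensor //.
by move=> k; exact: mb01_haar_w.
Qed.

(** The Dirichlet kernel of the Haar system. It is a nonnegative approximate identity: its integral
    is 1 because only index 1 has nonzero mean, and it vanishes at distance more than 2^(-K) from
    the diagonal. *)
Definition haar_ker K (u t : R) : R := \sum_(0 <= n < 2 ^ K) haar n.+1 u * haar n.+1 t.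

Lemma mb01_sum (T : Type) (s : seq T) (phi : T -> R -> R) :
  (forall i, mb01 (phi i)) ->
  mb01 (fun t => \sum_(i <- s) phi i t) /\
  int01 (fun t => \sum_(i <- s) phi i t) = \sum_(i <- s) int01 (phi i).
Proof.
move=> mphi; elim: s => [|i s [mS IH]].
  rewrite big_nil (_ : (fun t => _) = fun=> 0); last by apply/funext => t; rewrite big_nil.
  by rewrite int01_cst; split => //; exact: mb01_cst.
rewrite big_cons -IH -int01D // (_ : (fun t => _) = fun t => phi i t + \sum_(i <- s) phi i t).
  by split=> //; exact: mb01D.
by apply/funext => t; rewrite big_cons.
Qed.

Lemma mb01_haar_ker K u : mb01 (haar_ker K u).
Proof. by apply: (mb01_sum _ _).1 => n; apply/mb01Z/mb01_haar. Qed.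

Lemma int01_haar_ker K u : int01 (haar_ker K u) = 1.
Proof.
rewrite (mb01_sum _ _).2; last by move=> n; apply/mb01Z/mb01_haar.
have n2 : (0 < 2 ^ K)%N by rewrite expn_gt0.
rewrite big_ltn // int01Z ?int01_haar ?mulr1 //; last exact: mb01_haar.
rewrite big_nat big1 ?addr0 // => i /andP[i0 _].
rewrite int01Z ?int01_haar ?mulr0 //; last exact: mb01_haar.
by rewrite eqSS eqn0Ngt i0 mulr0.
Qed.

Lemma haar_ker_ge0 K u t : 0 <= u <= 1 -> 0 <= t <= 1 -> 0 <= haar_ker K u t.
Proof.
move=> u01 t01; rewrite /haar_ker haar_kernel // mulr_ge0 ?exprn_ge0 //.
by apply: sumr_ge0 => i _; rewrite mulr_ge0 ?dhat_ge0.
Qed.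

Lemma haar_ker_supp K u t : 0 <= u <= 1 -> 0 <= t <= 1 -> haar_ker K u t != 0 ->
  `|u - t| <= 2^-1 ^+ K.
Proof.
move=> u01 t01; rewrite /haar_ker haar_kernel // mulf_eq0 negb_or => /andP[_].
apply: contraNT => ut; rewrite big1 // => i _; apply/eqP; rewrite mulf_eq0.
apply: contraNT ut; rewrite negb_or => /andP[/dhat_supp + /dhat_supp].
by rewrite !dyadS => /andP[? ?] /andP[? ?]; rewrite ler_norml; apply/andP; split; lra.
Qed.

Lemma haar_psum_ker K g x : unif_cont g -> in_cube x ->
  haar_psum K g x = cube_integral (tensor (fun k => haar_ker K (extend 0 x k)) g).
Proof.
move=> ug xc; rewrite /haar_psum /haar_coef.
pose n (t : {ffun 'I_d -> 'I_(2 ^ K)}) s := (t s).+1.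
have ok (f : {ffun 'I_d -> 'I_(2 ^ K)}) :
    iint_ok (fun y => haar_d (n f) x * (g y * haar_d (n f) y)).
  have := @iint_ok_tensor (haar_w (n f)) g; rewrite -tensor_haar => okf.
  apply: iint_okZ; apply: okf => // k.
  exact: mb01_haar_w.
transitivity (\sum_f cube_integral (fun y => haar_d (n f) x * (g y * haar_d (n f) y))).
  apply: eq_bigr => t _; rewrite cube_integralZ; first by rewrite mulrC.
  by rewrite tensor_haar; apply: iint_ok_tensor => // k; exact: mb01_haar_w.
rewrite -(cube_integral_sum _ ok).2; apply: cube_integral_eq => y yc.
rewrite /tensor.
under [X in _ = _ * X]eq_bigr do rewrite extendE /haar_ker big_mkord.
rewrite bigA_distr_bigA mulr_sumr; apply: eq_bigr => t _.
by rewrite mulrCA big_split.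
Qed.

(** As the kernel has integral 1, the error is the average of [g y - g x] against it, and only
    points [y] close to [x] in every coordinate count. *)
Lemma haar_psum_approx K g x (e del : R) : unif_cont g -> in_cube x -> 
  (forall y, in_cube y -> (forall i, `|x i - y i| < del) -> `|g x - g y| <= e) ->
  2^-1 ^+ K < del -> 0 <= e -> `|haar_psum K g x - g x| <= e.
Proof.
move=> ug xc hd Kd e0; rewrite haar_psum_ker //.
set w := fun k => _; have mw k : mb01 (w k) by exact: mb01_haar_ker.
have w1 k : int01 (w k) = 1 by exact: int01_haar_ker.
have Ic c : cube_integral (tensor w (fun=> c)) = c.
  by rewrite cube_integral_tensor ?wint_cst //; exact: unif_cont_cst.
have okc c : iint_ok (tensor w (fun=> c)) by apply: iint_ok_tensor => //; exact: unif_cont_cst.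
have okg : iint_ok (tensor w g) by exact: iint_ok_tensor.
have -> : cube_integral (tensor w g) - g x =
  cube_integral (fun y => tensor w g y + tensor w (fun=> - g x) y).
  by rewrite cube_integralD // Ic.
rewrite -[leRHS]Ic; apply: cube_integral_norm => //; first exact: iint_okD.
move=> y yc; rewrite /tensor -mulrDl normrM.
have w0 i : 0 <= w (i : 'I_d) (y i) by rewrite /w extendE haar_ker_ge0.
rewrite [X in _ * X]ger0_norm ?prodr_ge0 //.
have [->|nz] := eqVneq (\prod_(i < d) w i (y i)) 0; first by rewrite !mulr0.
rewrite ler_wpM2r ?prodr_ge0 // distrC hd // => i; apply: le_lt_trans Kd.
apply: haar_ker_supp => //; move/prodf_neq0: nz => /(_ i isT).
by rewrite /w extendE.
Qed.

End CubeIntegral.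

(** * Mixed differences and decay of Haar coefficients *)

Section MixedDifferences.
Variables (R : realType) (d : nat).
Implicit Types (x y : pt R d) (g G H : pt R d -> R) (k : nat) (t u v : R).
Implicit Types (p : nat * (R * R)) (us : seq (nat * (R * R))).

Fixpoint mdiff us g x : R :=
  if us is (k, (u, v)) :: us' then mdiff us' g (setc x k u) - mdiff us' g (setc x k v)
  else g x.

Definition okdiff us := all (fun p => [&& 0 <= p.2.1 <= 1 & 0 <= p.2.2 <= 1]) us.
Definition gap p : R := `|p.2.1 - p.2.2|.

Lemma mdiff_setc us g x k t : k \notin map fst us ->
  mdiff us (fun x => g (setc x k t)) x = mdiff us g (setc x k t).
Proof.
elim: us x => [//|[s [u v]] us IH] x /=; rewrite inE negb_or => /andP[ks kus].
by rewrite !IH // ![setc (setc x s _) k _]setcC // eq_sym.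
Qed.

Lemma mdiffB us g h x : mdiff us (fun x => g x - h x) x = mdiff us g x - mdiff us h x.
Proof. by elim: us x => [//|[s [u v]] us IH] x /=; rewrite !IH; ring. Qed.

(** The difference that will be estimated by the Hoelder condition may stand anywhere in the list;
    here it is absorbed into the function. *)
Lemma mdiff_move us1 us2 k u v g x : k \notin map fst (us1 ++ us2) ->
  mdiff (us1 ++ (k, (u, v)) :: us2) g x =
  mdiff (us1 ++ us2) (fun x => g (setc x k u) - g (setc x k v)) x.
Proof.
elim: us1 x => [|[s [u1 v1]] us1 IH] x /=.
  by move=> kus; rewrite mdiffB !mdiff_setc.
by rewrite inE negb_or => /andP[_ kus]; rewrite !IH.
Qed.

Lemma cont01B (phi psi : R -> R) : cont01 phi -> cont01 psi ->
  cont01 (fun t => phi t - psi t).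
Proof.
move=> c1 c2 t t01 e e0; have e20 : 0 < e / 2 by rewrite divr_gt0.
have [d1 d10 h1] := c1 t t01 _ e20; have [d2 d20 h2] := c2 t t01 _ e20.
exists (Num.min d1 d2); first by rewrite lt_min d10.
move=> t' t'01; rewrite lt_min => /andP[/(h1 _ t'01) k1 /(h2 _ t'01) k2].
rewrite (_ : _ - _ = (phi t' - phi t) - (psi t' - psi t)); last by ring.
by rewrite (le_lt_trans (ler_normB _ _)) // [e]splitr ltrD.
Qed.

Lemma mdiff_cont us g x k : okdiff us -> in_cube x -> k \notin map fst us ->
  (forall x, in_cube x -> cont01 (fun t => g (setc x k t))) ->
  cont01 (fun t => mdiff us g (setc x k t)).
Proof.
move=> + + + cg; elim: us x => [|[s [u v]] us IH] x /=; first by move=> *; exact: cg.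
move=> /andP[/andP[/= u01 v01] ok] xc; rewrite inE negb_or => /andP[ks kus].
have c1 := IH _ ok (setc_cube s xc u01) kus.
have c2 := IH _ ok (setc_cube s xc v01) kus.
have := cont01B c1 c2; congr cont01.
by apply/funext => t; rewrite ![setc (setc x k _) s _]setcC.
Qed.

Lemma mdiff_derive us g g' x k t : okdiff us -> in_cube x -> k \notin map fst us ->
  (forall x, in_cube x -> is_derive t 1 (fun t => g (setc x k t)) (g' (setc x k t))) ->
  is_derive t 1 (fun t => mdiff us g (setc x k t)) (mdiff us g' (setc x k t)).
Proof.
move=> + + + dg; elim: us x => [|[s [u v]] us IH] x /=; first by move=> *; exact: dg.
move=> /andP[/andP[/= u01 v01] ok] xc; rewrite inE negb_or => /andP[ks kus].
have c1 := IH _ ok (setc_cube s xc u01) kus.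
have c2 := IH _ ok (setc_cube s xc v01) kus.
rewrite (_ : (fun t => _) = (fun t => mdiff us g (setc (setc x s u) k t)) -
    (fun t => mdiff us g (setc (setc x s v) k t))); last first.
  by apply/funext => t'; rewrite ![setc (setc x k _) s _]setcC.
by rewrite ![setc (setc x k _) s _]setcC //; exact: is_deriveB.
Qed.

(** Differentiability is asked in the open interval only: at 0 and 1 [partial_within] provides just
    one-sided derivatives. *)
Lemma MVT01 (phi dphi : R -> R) u v M : 0 <= u <= 1 -> 0 <= v <= 1 ->
  (forall t, 0 < t < 1 -> is_derive t 1 phi (dphi t)) -> cont01 phi ->
  (forall t, 0 <= t <= 1 -> `|dphi t| <= M) -> `|phi u - phi v| <= M * `|u - v|.
Proof.
move=> + + hd hc hM; wlog uv : u v / u <= v => [hw u01 v01|u01 v01].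
  have [uv|/ltW vu] := leP u v; first exact: hw.
  by rewrite distrC [`|u - v|]distrC; exact: hw.
have cc : {within `[u, v], continuous phi}.
  apply: (@subspace_eq_continuous _ _ _ (phi \o @clamp R)).
    by move=> t; rewrite inE /= in_itv /= => ?; rewrite clamp_id //; lra.
  by apply: continuous_subspaceT; exact: cont01_clamp.
have dd t : t \in `]u, v[ -> is_derive t 1 phi (dphi t).
  by rewrite in_itv /= => ?; apply: hd; lra.
have [c] := MVT_segment uv dd cc; rewrite in_itv /= => cuv e.
rewrite distrC e normrM distrC ler_wpM2r // hM //; lra.
Qed.

(** The mean value theorem in one coordinate after another trades a difference for its gap and one
    more derivative, recorded in [ks]. Only directions occurring in [us] are differentiated, so that
    [G] may itself be an increment in some other coordinate. *)
Lemma mdiff_bound us (G : seq 'I_d -> pt R d -> R) ks m M x :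
  okdiff us -> uniq (map fst us) -> in_cube x ->
  (forall p, p \in us -> (p.1 < d)%N) ->
  (forall ks (s : 'I_d) x t, (size ks < m)%N -> val s \in map fst us -> in_cube x ->
     0 < t < 1 -> is_derive t 1 (fun t => G ks (setc x s t)) (G (s :: ks) (setc x s t))) ->
  (forall ks (s : 'I_d) x, (size ks <= m)%N -> val s \in map fst us -> in_cube x ->
     cont01 (fun t => G ks (setc x s t))) ->
  (forall ks x, size ks = m -> in_cube x -> `|G ks x| <= M) ->
  (size us + size ks = m)%N ->
  `|mdiff us (G ks) x| <= M * \prod_(p <- us) gap p.
Proof.
move=> + + + + + + hM; elim: us ks x => [|[k [u v]] us IH] ks x /=.
  by move=> _ _ xc _ _ _ sk; rewrite big_nil mulr1 hM.
move=> /andP[/andP[/= u01 v01] ok] /andP[kus uus] xc ud hd hc sk.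
have kd : (k < d)%N by apply: (ud (k, (u, v))); rewrite inE eqxx.
pose s := Ordinal kd; rewrite big_cons mulrCA mulrC.
have skm : (size ks < m)%N by rewrite -sk addSn ltnS leq_addl.
apply: (@MVT01 (fun t => mdiff us (G ks) (setc x s t))
  (fun t => mdiff us (G (s :: ks)) (setc x s t))) => //.
- move=> t t01; apply: mdiff_derive => // y yc; apply: hd => //.
  by rewrite inE eqxx.
- by apply: mdiff_cont => // y yc; apply: hc => //; [exact: ltnW|by rewrite inE eqxx].
move=> t t01; apply: IH => //.
- exact: setc_cube.
- by move=> p pus; apply: ud; rewrite inE pus orbT.
- by move=> ks' s' y t' h1 h2; apply: hd => //; rewrite inE h2 orbT.
- by move=> ks' s' y h1 h2; apply: hc => //; rewrite inE h2 orbT.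
by rewrite /= addnS -addSn.
Qed.

(** At an interior value of the coordinate every small increment stays in the cube, so the
    restricted limit is an ordinary derivative. *)
Lemma partial_within_derive g (s : 'I_d) x t a : in_cube x -> 0 < t < 1 ->
  partial_within g s (setc x s t) a -> is_derive t 1 (fun t => g (setc x s t)) a.
Proof.
move=> xc t01 /cvgrPdist_lt hg.
have cv : h^-1 *: (((fun t => g (setc x s t)) \o shift t) (h *: 1) - g (setc x s t))
   @[h --> (0 : R)^'] --> a.
  apply/cvgrPdist_lt => e e0; have := hg e e0; rewrite near_withinE => hn.
  have n1 : \forall h \near (0 : R)^', 0 < t + h < 1.
    apply/nbhs_ballP; exists (Num.min t (1 - t)); first by rewrite /= lt_min; lra.
    move=> h; rewrite /ball /= sub0r normrN lt_min !ltr_norml => /andP[/andP[? ?] /andP[? ?]] _.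
    by apply/andP; split; lra.
  apply: filterS2 hn n1 => h hn h01.
  have sh : Defs.shift (setc x s t) s h = setc x s (t + h).
    apply/funext => i; rewrite /Defs.shift /setc.
    have [->|is_] := eqVneq i s; first by rewrite eqxx.
    by have /negbTE -> : val i != val s by rewrite val_eqE.
  have : in_cube (Defs.shift (setc x s t) s h) by rewrite sh; apply: setc_cube => //; lra.
  move=> /hn; rewrite sh /= mulrC; congr (`|_ - _ * (g (setc _ _ _) - _)| < _).
  by rewrite scaler1 addrC.
by split; [apply/cvg_ex; exists a|exact: cvg_lim].
Qed.

End MixedDifferences.

(** * Choosing coordinates by averaging over rotations *)

Section Rotations.
Variable R : realType.

(** Entry [i] of [rot r s] comes from position [i + r] modulo the size, which is symmetric in [i]
    and [r]. *)
Lemma nth_rotC (T : Type) (x0 : T) (s : seq T) i r : (i < size s)%N -> (r < size s)%N ->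
  nth x0 (rot r s) i = nth x0 (rot i s) r.
Proof.
move=> im rm; rewrite /rot !nth_cat !size_drop ltn_subRL [in RHS]ltn_subRL addnC.
case: ifP => h; first by rewrite !nth_drop addnC.
have h' : (size s <= i + r)%N by rewrite leqNgt h.
by rewrite !nth_take; [congr nth|..]; lia.
Qed.

(* Averaged over all rotations, each position of [rot r s] sees every element of [s] once. *)
Lemma good_rotation (s : seq nat) (J : nat -> R) (l : nat) (a : R) :
  (l < size s)%N -> exists r : nat,
    (l%:R + a) * \sum_(k <- s) J k <=
    (size s)%:R * (\sum_(k <- take l (rot r s)) J k + a * J (nth 0%N (rot r s) l)).
Proof.
move=> ls; set m := size s; set T := (_ * _)%R.
pose E r := \sum_(k <- take l (rot r s)) J k + a * J (nth 0%N (rot r s) l).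
have col i : (i < m)%N -> \sum_(r < m) J (nth 0%N (rot r s) i) = \sum_(k <- s) J k.
  move=> im; rewrite -(perm_big _ (permEl (perm_rot i s))) (big_nth 0%N) big_mkord size_rot.
  by apply: eq_bigr => r _; rewrite nth_rotC.
have tot : \sum_(r < m) E r = T.
  rewrite big_split /= -mulr_sumr col // /T mulrDl; congr (_ + _).
  transitivity (\sum_(r < m) \sum_(i < l) J (nth 0%N (rot r s) i)).
    apply: eq_bigr => r _; rewrite (big_nth 0%N) big_mkord size_takel ?size_rot ?(ltnW ls) //.
    by apply: eq_bigr => i _; rewrite nth_take.
  rewrite exchange_big /= (eq_bigr (fun=> \sum_(k <- s) J k)); last first.
    by move=> i _; rewrite col // (ltn_trans _ ls).
  by rewrite sumr_const card_ord mulr_natl.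
apply: contrapT => /forallNP h.
have : \sum_(r < m) m%:R * E r < \sum_(r < m) T.
  apply: ltr_sum; last by move=> r _; rewrite ltNge; apply/negP; exact: h.
  by apply/hasP; exists (Ordinal ls); rewrite ?mem_index_enum.
by rewrite -mulr_sumr tot sumr_const card_ord mulr_natl ltxx.
Qed.

End Rotations.

(** * Haar coefficients as averages of mixed differences *)

Section CoefficientBound.
Variables (R : realType) (d : nat).
Implicit Types (x y : pt R d) (g G H : pt R d -> R) (k : nat) (t u v : R).
Implicit Types (p : nat * (R * R)) (us : seq (nat * (R * R))) (n : 'I_d -> nat).

Lemma mdiff_int us H (w : R -> R) k x : mb01 w -> okdiff us -> k \notin map fst us ->
  in_cube x -> (forall x, in_cube x -> cont01 (fun t => H (setc x k t))) ->
  mdiff us (fun x => int01 (fun t => H (setc x k t) * w t)) x =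
  int01 (fun t => mdiff us H (setc x k t) * w t).
Proof.
move=> mw + + + cH; elim: us x => [//|[s [u v]] us IH] x /=.
move=> /andP[/andP[/= u01 v01] ok]; rewrite inE negb_or => /andP[ks kus] xc.
have us01 := setc_cube s xc u01; have vs01 := setc_cube s xc v01.
have mbd y : in_cube y -> mb01 (fun t => mdiff us H (setc y k t) * w t).
  move=> yc; apply: mb01M => //; apply: cont01_mb.
  by apply: mdiff_cont.
rewrite !IH // -int01B; [|exact: mbd..].
by apply: int01_eq => t _; rewrite -mulrBl ![setc (setc x k t) s _]setcC.
Qed.

(** The integrals are removed from the outermost one inwards. An integral over a coordinate in [A]
    becomes a further difference in [us], by cancellation; any other is estimated by the supremum.
    When none is left, [us] carries all coordinates of [A] and the hypothesis on [g] applies. *)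
Lemma wint_mdiff_bound n g (A : pred nat) (N := extend 1%N n) (M : R) :
  (forall i, 0 < n i)%N -> unif_cont g -> (forall k, A k -> 0 < lev (N k))%N ->
  (forall us x, okdiff us -> map fst us = [seq k <- iota 0 d | A k] ->
     (forall p, p \in us -> gap p <= 2^-1 ^+ lev (N p.1)) -> in_cube x ->
     `|mdiff us g x| <= M) ->
  forall k us x, (k <= d)%N -> okdiff us -> map fst us = [seq j <- iota k (d - k) | A j] ->
    (forall p, p \in us -> gap p <= 2^-1 ^+ lev (N p.1)) -> in_cube x ->
    `|mdiff us (wint (haar_w n) k g) x| <= M * \prod_(j < k) (Num.sqrt 2)^-1 ^+ lev (N j).
Proof.
move=> n0 ug AJ hM; elim=> [|k IH] us x kd ok eus gus xc.
  by rewrite big_ord0 mulr1; apply: hM => //; rewrite eus subn0.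
have mw j : mb01 (haar_w n j : R -> R) by exact: mb01_haar_w.
have kus : k \notin map fst us.
  by rewrite eus mem_filter mem_iota ltnn andbF.
have cw y : in_cube y -> cont01 (fun t => wint (haar_w n) k g (setc y k t)).
  by move=> yc; apply: unif_cont_setc => //; exact: unif_cont_wint.
rewrite [wint _ _ _]/= mdiff_int // big_ord_recr /= mulrA.
have mH : mb01 (fun t => mdiff us (wint (haar_w n) k g) (setc x k t)).
  by apply/cont01_mb/mdiff_cont.
have Nk : (0 < N k)%N by exact: extend_gt0.
have iotaE : iota k (d - k) = k :: iota k.+1 (d - k.+1).
  by rewrite -(subnSK kd).
have [Ak|Ak] := boolP (A k).
  apply: haar_integral_osc => //; first exact: AJ.
  move=> u v u01 v01 uv.
  apply: (IH ((k, (u, v)) :: us)) => //=; [exact: ltnW|by rewrite u01 v01| |].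
    by rewrite iotaE /= Ak eus.
  by move=> p; rewrite inE => /orP[/eqP -> //|]; exact: gus.
apply: haar_integral_le => // t t01; apply: IH => //; first exact: ltnW.
  by rewrite iotaE /= (negbTE Ak).
exact: setc_cube.
Qed.

Lemma haar_coef_bound n g (A : pred nat) (N := extend 1%N n) (M : R) :
  (forall i, 0 < n i)%N -> unif_cont g -> (forall k, A k -> 0 < lev (N k))%N ->
  (forall us x, okdiff us -> map fst us = [seq k <- iota 0 d | A k] ->
     (forall p, p \in us -> gap p <= 2^-1 ^+ lev (N p.1)) -> in_cube x ->
     `|mdiff us g x| <= M) ->
  `|haar_coef n g| <= M * \prod_(i < d) (Num.sqrt 2)^-1 ^+ lev (n i).
Proof.
move=> n0 ug AJ hM; rewrite haar_coef_wint //.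
have := wint_mdiff_bound n0 ug AJ hM (us := [::]) (x := fun=> 0) (leqnn d).
rewrite /= subnn => /(_ isT erefl) h.
apply: le_trans (h _ _) _ => //; first exact: cube0.
by under eq_bigr do rewrite extendE.
Qed.

Lemma mdiff_eq us g h x : okdiff us -> in_cube x -> (forall x, in_cube x -> g x = h x) ->
  mdiff us g x = mdiff us h x.
Proof.
move=> + + e; elim: us x => [|[s [u v]] us IH] x /=; first by move=> _; exact: e.
by move=> /andP[/andP[/= u01 v01] ok] xc; rewrite !IH //; exact: setc_cube.
Qed.

Lemma eucl_dist_setc x k t u : (k < d)%N -> eucl_dist (setc x k t) (setc x k u) = `|t - u|.
Proof.
move=> kd; rewrite /eucl_dist (bigD1 (Ordinal kd)) //= big1.
  by rewrite /setc eqxx addr0 sqrtr_sqr.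
by move=> i ik; rewrite /setc !ifN // subrr expr0n.
Qed.

Lemma cont_on_cube_setc g (s : 'I_d) x : cont_on_cube g -> in_cube x ->
  cont01 (fun t => g (setc x s t)).
Proof.
move=> cg xc t t01 e e0.
have [del del0 hd] := cg _ (setc_cube s xc t01) _ e0; exists del => // t' t'01 tt'.
by apply: hd; [exact: setc_cube|rewrite eucl_dist_setc // distrC].
Qed.

End CoefficientBound.

(** * Decay of the Haar coefficients of a smooth function *)

Section CoefficientDecay.
Variables (R : realType) (d l : nat) (alpha Cf : R) (G : seq 'I_d -> pt R d -> R).
Variables (g : pt R d -> R).
Hypotheses (d0 : (0 < d)%N) (alpha0 : 0 < alpha) (Cf0 : 0 < Cf).
Hypothesis G0 : forall x, in_cube x -> G [::] x = g x.
Hypothesis Gder : forall ks s x, (size ks < l)%N -> in_cube x ->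
  partial_within (G ks) s x (G (s :: ks) x).
Hypothesis Gcont : forall ks, (size ks <= l)%N -> cont_on_cube (G ks).
Hypothesis Gbd : forall ks x, (size ks <= l)%N -> in_cube x -> `|G ks x| <= Cf.
Hypothesis Ghold : forall ks x1 x2, size ks = l -> in_cube x1 -> in_cube x2 ->
  `|G ks x1 - G ks x2| <= Cf * eucl_dist x1 x2 `^ alpha.
Implicit Types (x y : pt R d) (n : 'I_d -> nat) (us : seq (nat * (R * R))).

Lemma mdiff_smooth us x : okdiff us -> uniq (map fst us) ->
  (forall p, p \in us -> (p.1 < d)%N) -> (size us <= l)%N -> in_cube x ->
  `|mdiff us g x| <= Cf * \prod_(p <- us) gap p.
Proof.
move=> ok uus ud sl xc; rewrite -(mdiff_eq ok xc G0).
apply: (mdiff_bound (m := size us)) => //; last by rewrite addn0.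
- move=> ks s y t sk _ yc t01; apply: partial_within_derive => //.
  apply: Gder; first exact: leq_trans sk sl.
  by apply: setc_cube => //; lra.
- move=> ks s y sk _ yc; apply: cont_on_cube_setc => //.
  by apply: Gcont; exact: leq_trans sk sl.
by move=> ks y sk yc; apply: Gbd => //; rewrite sk.
Qed.

(** The other [l] differences become derivatives of the increment in coordinate [k]; to the
    increment of the derivative of order [l] so obtained the Hoelder condition applies. *)
Lemma mdiff_holder us1 us2 k u v x : okdiff (us1 ++ (k, (u, v)) :: us2) ->
  uniq (map fst (us1 ++ (k, (u, v)) :: us2)) ->
  (forall p, p \in us1 ++ (k, (u, v)) :: us2 -> (p.1 < d)%N) ->
  size (us1 ++ us2) = l -> in_cube x ->
  `|mdiff (us1 ++ (k, (u, v)) :: us2) g x| <=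
  Cf * `|u - v| `^ alpha * \prod_(p <- us1 ++ us2) gap p.
Proof.
move=> ok uus ud sl xc; rewrite -(mdiff_eq ok xc G0).
have [uv ok'] : (0 <= u <= 1 /\ 0 <= v <= 1) /\ okdiff (us1 ++ us2).
  by move: ok; rewrite /okdiff !all_cat /= => /and3P[-> /andP[-> ->] ->].
have [u01 v01] := uv.
have pe : perm_eq (us1 ++ (k, (u, v)) :: us2) ((k, (u, v)) :: us1 ++ us2).
  by rewrite -cat1s perm_catCA.
have /andP[kus uus'] : uniq (k :: map fst (us1 ++ us2)).
  by rewrite -(perm_uniq (perm_map fst pe)).
have kd : (k < d)%N by apply: (ud (k, (u, v))); rewrite (perm_mem pe) inE eqxx.
rewrite mdiff_move //.
apply: (mdiff_bound (G := fun ks x => G ks (setc x k u) - G ks (setc x k v)) (m := l)) => //.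
- by move=> p pus; apply: ud; rewrite (perm_mem pe) inE pus orbT.
- move=> ks s y t sk sus yc t01.
  have sk' : val s != k by apply: contraNneq kus => <-.
  have der w : 0 <= w <= 1 ->
    is_derive t 1 (fun t => G ks (setc (setc y k w) s t)) (G (s :: ks) (setc (setc y k w) s t)).
    move=> w01; apply: partial_within_derive => //; first exact: setc_cube.
    apply: Gder => //; apply: setc_cube; first exact: setc_cube.
    by lra.
  rewrite (_ : (fun t => _) = (fun t => G ks (setc (setc y k u) s t)) -
    (fun t => G ks (setc (setc y k v) s t))); last first.
    by apply/funext => t'; rewrite ![setc (setc y s _) k _]setcC.
  by rewrite ![setc (setc y s _) k _]setcC //; apply: is_deriveB; exact: der.
- move=> ks s y sk sus yc; have sk' : val s != k by apply: contraNneq kus => <-.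
  have c w : 0 <= w <= 1 -> cont01 (fun t => G ks (setc (setc y k w) s t)).
    by move=> w01; apply: cont_on_cube_setc; [exact: Gcont|exact: setc_cube].
  have := cont01B (c _ u01) (c _ v01); congr cont01.
  by apply/funext => t; rewrite ![setc (setc y s _) k _]setcC.
- move=> ks y sk yc; rewrite -(eucl_dist_setc y u v kd).
  by apply: Ghold => //; exact: setc_cube.
by rewrite addn0.
Qed.

(** The guaranteed gain per unit of level: 1 if every coordinate of positive level can take a
    derivative, and the average share of l + alpha among d coordinates otherwise. *)
Definition beta : R := Num.min 1 ((l%:R + alpha) / d%:R).
Definition theta : R := 2 `^ (- beta).

Lemma haar_coef_decay n : (forall i, 0 < n i)%N -> unif_cont g ->
  `|haar_coef n g| <= Cf * \prod_(i < d) ((Num.sqrt 2)^-1 ^+ lev (n i) * theta ^+ lev (n i)).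
Proof.
move=> n0 ug; set N := extend 1%N n; pose J k : R := (lev (N k))%:R.
have J0 k : 0 <= J k by exact: ler0n.
have powN (a b : R) : (a <= b) -> (2 : R) `^ (- b) <= 2 `^ (- a).
  by move=> ab; rewrite ler_powR ?ler1n // lerN2.
have half j : (2^-1 : R) ^+ j = 2 `^ (- j%:R) by rewrite powRN powR_mulrn // exprVn.
have halfs (s : seq nat) : \prod_(k <- s) (2^-1 : R) ^+ lev (N k) = 2 `^ (- \sum_(k <- s) J k).
  elim: s => [|k s IH]; first by rewrite !big_nil oppr0 powRr0.
  by rewrite !big_cons IH half opprD powRD // pnatr_eq0 implybT.
have thetas (s : seq nat) :
    \prod_(k <- s) theta ^+ lev (N k) = 2 `^ (- (beta * \sum_(k <- s) J k)).
  elim: s => [|k s IH]; first by rewrite !big_nil mulr0 oppr0 powRr0.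
  rewrite !big_cons IH mulrDr opprD powRD ?pnatr_eq0 ?implybT //; congr (_ * _).
  by rewrite -powR_mulrn ?powR_ge0 // -powRrM mulNr.
have beta1 : beta <= 1 by rewrite ge_min lexx.
have betal : beta <= (l%:R + alpha) / d%:R by rewrite ge_min lexx orbT.
have la0 : 0 < l%:R + alpha by rewrite ltr_wpDl.
set S := [seq k <- iota 0 d | (0 < lev (N k))%N].
have SJ : \sum_(k <- S) J k = \sum_(k <- iota 0 d) J k.
  rewrite big_filter big_mkcond; apply: eq_bigr => k _; rewrite lt0n /J.
  by case: eqP => [->|].
have SJ0 : 0 <= \sum_(k <- S) J k by apply: sumr_ge0.
(* [A] collects the coordinates in which the cancellation of the Haar function is used; in the
   others only its size counts. *)
suff main : exists2 A : pred nat, (forall k, A k -> 0 < lev (N k))%N &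
  forall us x, okdiff us -> map fst us = [seq k <- iota 0 d | A k] ->
     (forall p, p \in us -> gap p <= 2^-1 ^+ lev (N p.1)) -> in_cube x ->
     `|mdiff us g x| <= Cf * 2 `^ (- (beta * \sum_(k <- S) J k)).
  have [A AJ hA] := main; rewrite big_split /= mulrCA mulrC.
  apply: le_trans (haar_coef_bound n0 ug AJ hA) _; rewrite SJ -thetas.
  rewrite [X in _ * X * _ <= _](_ : _ = \prod_(i < d) theta ^+ lev (n i)) //.
  transitivity (\prod_(i < d) theta ^+ lev (N i)).
    by rewrite -(big_mkord xpredT (fun k => theta ^+ lev (N k))) /index_iota subn0.
  by apply: eq_bigr => i _; rewrite /N extendE.
have prod_gap us (s : seq nat) : (forall p, p \in us -> gap p <= 2^-1 ^+ lev (N p.1)) ->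
    perm_eq (map fst us) s -> \prod_(p <- us) gap p <= 2 `^ (- \sum_(k <- s) J k).
  move=> gus ps; rewrite -halfs -(perm_big _ ps) big_map.
  rewrite big_seq [leRHS]big_seq; apply: ler_prod => p /gus ->.
  by rewrite /gap normr_ge0.
have us_lt us (A : pred nat) : map fst us = [seq k <- iota 0 d | A k] ->
    forall p, p \in us -> (p.1 < d)%N.
  by move=> e p /(map_f fst); rewrite e mem_filter mem_iota => /andP[].
(* With at most [l] coordinates of positive level each takes a derivative, giving exponent 1. *)
have [Sl|lS] := leqP (size S) l.
  exists (fun k => 0 < lev (N k))%N => // us x ok eus gus xc.
  have us_uniq : uniq (map fst us) by rewrite eus filter_uniq // iota_uniq.
  apply: le_trans (mdiff_smooth ok us_uniq (us_lt _ _ eus) _ xc) _.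
    by rewrite -(size_map fst) eus.
  rewrite ler_wpM2l ?(ltW Cf0) // (le_trans (prod_gap us S gus _)) ?eus //.
  by apply: powN; rewrite ler_piMl.
(* Otherwise the first [l] coordinates of the rotated list take derivatives and the next one, [t],
   takes the Hoelder increment. *)
have [r hr] := good_rotation J alpha lS.
set s := rot r S in hr; set t := nth 0%N s l in hr.
have ss : (l < size s)%N by rewrite size_rot.
have ct : take l.+1 s = rcons (take l s) t by rewrite (take_nth 0%N).
have Suniq : uniq S by rewrite filter_uniq // iota_uniq.
have cS k : k \in take l.+1 s -> k \in S by move=> /mem_take; rewrite mem_rot.
exists (mem (take l.+1 s)) => [k /cS|us x ok eus gus xc]; first by rewrite mem_filter => /andP[].
have us_uniq : uniq (map fst us) by rewrite eus filter_uniq // iota_uniq.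
have pus : perm_eq (map fst us) (take l.+1 s).
  rewrite eus; apply: uniq_perm; first by rewrite filter_uniq // iota_uniq.
    by rewrite take_uniq // rot_uniq.
  move=> k; rewrite mem_filter /=; apply/andP/idP => [[]//|kc]; split => //.
  by have := cS _ kc; rewrite mem_filter => /andP[].
have /mapP[[t' [u v]] pin /= tt'] : t \in map fst us.
  by rewrite (perm_mem pus) ct mem_rcons inE eqxx.
rewrite -{t'}tt' in pin.
have ud := us_lt _ _ eus; clear eus.
(* The list [us] follows the order of [iota 0 d], not that of the rotation, so [t] may stand in its
   middle. *)
move: pin ok gus us_uniq pus ud => /splitPr[us1 us2] ok gus us_uniq pus ud.
have gt := gus (t, (u, v)); rewrite mem_cat inE eqxx orbT /= in gt.
have pus' : perm_eq (map fst (us1 ++ us2)) (take l s).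
  rewrite -(perm_cons t); apply: (@perm_trans _ (take l.+1 s)); last by rewrite ct perm_rcons.
  apply: (perm_trans _ pus); rewrite -[_ :: _]/(map fst ((t, (u, v)) :: us1 ++ us2)) perm_map //.
  by rewrite perm_sym -cat1s perm_catCA.
have sl : size (us1 ++ us2) = l.
  by rewrite -(size_map fst) (perm_size pus') size_takel // ltnW.
apply: le_trans (mdiff_holder ok us_uniq ud sl xc) _.
rewrite -mulrA ler_wpM2l ?(ltW Cf0) //.
have h1 : `|u - v| `^ alpha <= 2 `^ (- (alpha * J t)).
  apply: le_trans (_ : (2^-1 ^+ lev (N t)) `^ alpha <= _).
    apply: ge0_ler_powR; [exact: ltW|exact: normr_ge0|exact: exprn_ge0|exact: gt].
  by rewrite half -powRrM mulNr mulrC.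
have h2 : \prod_(p <- us1 ++ us2) gap p <= 2 `^ (- \sum_(k <- take l s) J k).
  apply: prod_gap => // p pin; apply: gus; move: pin; rewrite !mem_cat inE.
  by case/orP => ->; rewrite ?orbT.
apply: le_trans (ler_pM _ _ h1 h2) _; rewrite ?powR_ge0 //.
  by apply: prodr_ge0 => p _; exact: normr_ge0.
rewrite -powRD ?pnatr_eq0 ?implybT // -opprD; apply: powN; rewrite addrC.
(* This turns the share (l + alpha) / size S given by the rotation into the uniform (l + alpha) /
   d. *)
have Sd : (size S <= d)%N by rewrite size_filter -[d in (_ <= d)%N](size_iota 0) count_size.
have S0 : 0 < (size S)%:R :> R by rewrite ltr0n (leq_ltn_trans _ lS).
rewrite -(ler_pM2l S0); apply: le_trans hr; rewrite mulrA ler_wpM2r //.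
have dR : 0 < d%:R :> R by rewrite ltr0n.
apply: le_trans (ler_wpM2l (ltW S0) betal) _.
rewrite mulrCA ler_piMr ?(ltW la0) // ler_pdivrMr // mul1r ler_nat //.
Qed.

End CoefficientDecay.

(** * Dependence on the parameter *)

Section Modulus.
Variables (R : realType) (d l : nat) (alpha Cf : R).
Hypotheses (d0 : (0 < d)%N) (alpha0 : 0 < alpha) (Cf0 : 0 < Cf).
Implicit Types (x y : pt R d) (g : pt R d -> R).

(** Solves Cf * r^alpha = e when only the Hoelder condition is available, and Cf * r = e when there
    is a bounded first derivative. *)
Definition osc_radius (e : R) : R := if l == 0%N then (e / Cf) `^ alpha^-1 else e / Cf.

Lemma osc_radius_gt0 e : 0 < e -> 0 < osc_radius e.
Proof. by move=> e0; rewrite /osc_radius; case: ifP => _; [apply: powR_gt0|]; exact: divr_gt0. Qed.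

Lemma coord_osc (G : seq 'I_d -> pt R d -> R) g (e : R) k x (u v : R) :
  (forall x, in_cube x -> G [::] x = g x) ->
  (forall ks s x, (size ks < l)%N -> in_cube x -> partial_within (G ks) s x (G (s :: ks) x)) ->
  (forall ks, (size ks <= l)%N -> cont_on_cube (G ks)) ->
  (forall ks x, (size ks <= l)%N -> in_cube x -> `|G ks x| <= Cf) ->
  (forall ks x1 x2, size ks = l -> in_cube x1 -> in_cube x2 ->
    `|G ks x1 - G ks x2| <= Cf * eucl_dist x1 x2 `^ alpha) ->
  (k < d)%N -> in_cube x -> 0 <= u <= 1 -> 0 <= v <= 1 -> 0 < e ->
  `|u - v| < osc_radius e -> `|g (setc x k u) - g (setc x k v)| <= e.
Proof.
move=> G0 Gder Gcont Gbd Ghold kd xc u01 v01 e0.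
have ok : okdiff [:: (k, (u, v))] by rewrite /= u01 v01.
have kd' p : p \in [:: (k, (u, v))] -> (p.1 < d)%N by rewrite inE => /eqP ->.
rewrite /osc_radius; case: ifP => [/eqP l0|/negbT l0] uv.
  have := mdiff_holder G0 Gder Gcont Ghold (us1 := [::]) (us2 := [::]) ok isT kd' (esym l0) xc.
  rewrite /= big_nil mulr1 => /le_trans; apply.
  rewrite mulrC -ler_pdivlMr //; apply: le_trans (_ : ((e / Cf) `^ alpha^-1) `^ alpha <= _).
    by apply: ge0_ler_powR; [exact: ltW|exact: normr_ge0|exact: powR_ge0|exact: ltW].
  by rewrite -powRrM mulVf ?gt_eqF // powRr1 // divr_ge0 ?ltW.
have := mdiff_smooth G0 Gder Gcont Gbd ok isT kd' _ xc.
rewrite /= big_seq1 lt0n => /(_ l0) /le_trans; apply.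
by rewrite mulrC -ler_pdivlMr // ltW.
Qed.

Lemma coord_telescope g (e del : R) x y :
  (forall k x u v, (k < d)%N -> in_cube x -> 0 <= u <= 1 -> 0 <= v <= 1 -> `|u - v| < del ->
    `|g (setc x k u) - g (setc x k v)| <= e) ->
  in_cube x -> in_cube y -> (forall i, `|x i - y i| < del) -> `|g x - g y| <= d%:R * e.
Proof.
move=> osc xc yc xy; pose p k : pt R d := fun i => if (i < k)%N then y i else x i.
have pc k : in_cube (p k) by move=> i; rewrite /p; case: ifP.
suff main k : (k <= d)%N -> `|g x - g (p k)| <= k%:R * e.
  have := main d (leqnn d); rewrite (_ : p d = y) //.
  by apply/funext => i; rewrite /p ltn_ord.
elim: k => [|k IH] kd.
  by rewrite (_ : p 0%N = x) ?subrr ?normr0 ?mul0r.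
pose s := Ordinal kd.
have e1 : p k = setc (p k) k (x s).
  apply/funext => i; rewrite /setc /p; case: eqP => [ik|//].
  by rewrite ik ltnn; congr x; exact: val_inj.
have e2 : p k.+1 = setc (p k) k (y s).
  apply/funext => i; rewrite /setc /p ltnS leq_eqVlt /=; case: eqP => [ik|//].
  by congr y; exact: val_inj.
have := osc k (p k) (x s) (y s) kd (pc k) (xc s) (yc s) (xy s); rewrite -e1 -e2 => h.
have := ler_distD (g (p k)) (g x) (g (p k.+1)); have := IH (ltnW kd).
by rewrite -natr1 mulrDl mul1r; lra.
Qed.

(** The radius does not depend on [z], a consequence of the uniformity of [Cf]; this lets pointwise
    continuity in [z] be tested on a finite grid. *)
Definition equi_modulus (Z : Type) (f : Z -> pt R d -> R) := forall e : R, 0 < e ->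
  exists2 del : R, 0 < del & forall z x y, in_cube x -> in_cube y ->
    (forall i, `|x i - y i| < del) -> `|f z x - f z y| <= e.

Lemma equi_unif_cont (Z : Type) (f : Z -> pt R d -> R) z : equi_modulus f -> unif_cont (f z).
Proof. by move=> ef e /ef[del del0 h]; exists del => // x y; exact: h. Qed.

(* Pointwise continuity is uniform over the cube: compare on a finite grid. *)
Lemma equi_near (Z : topologicalType) (f : Z -> pt R d -> R) (z0 : Z) (e : R) :
  equi_modulus f -> (forall x, in_cube x -> continuous (fun z => f z x)) -> 0 < e ->
  \forall z \near z0, forall x, in_cube x -> `|f z x - f z0 x| <= e.
Proof.
move=> ef fc e0; have e30 : 0 < e / 3 by rewrite divr_gt0.
have [del del0 hd] := ef _ e30.
pose M := (Num.trunc del^-1).+1; have M0 : 0 < M%:R :> R by rewrite ltr0n.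
have Md : M%:R^-1 < del by rewrite invf_plt ?posrE // truncnS_gt.
pose q (t : {ffun 'I_d -> 'I_M.+1}) : pt R d := fun i => (t i)%:R / M%:R.
have qc t : in_cube (q t).
  move=> i; rewrite /q divr_ge0 //= ler_pdivrMr // mul1r ler_nat.
  by rewrite -ltnS ltn_ord.
have near_q : \forall z \near z0, forall t, `|f z0 (q t) - f z (q t)| < e / 3.
  by apply: filter_forall => t; have /cvgrPdist_lt := fc _ (qc t) z0; exact.
apply: filterS near_q => z hz x xc.
have tM i : (Num.trunc (M%:R * x i) < M.+1)%N.
  have /andP[x0 x1] := xc i; rewrite ltnS -(ler_nat R).
  apply: le_trans (_ : M%:R * x i <= _); first by rewrite truncn_le mulr_ge0.
  by rewrite ler_piMr.
pose t : {ffun 'I_d -> 'I_M.+1} := [ffun i => Ordinal (tM i)].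
have xq i : `|x i - q t i| < del.
  apply: le_lt_trans Md; have /andP[x0 x1] := xc i.
  rewrite /q ffunE /= -(ler_pM2l M0) mulfV ?gt_eqF // -{1}[M%:R]gtr0_norm // -normrM mulrBr.
  rewrite mulrCA mulfV ?gt_eqF // mulr1.
  have Mx : 0 <= M%:R * x i by rewrite mulr_ge0.
  have := truncn_itv Mx; rewrite -natr1 => /andP[? ?].
  by rewrite ler_norml; apply/andP; split; lra.
have h1 := hd z x (q t) xc (qc t) xq; have h2 := hd z0 x (q t) xc (qc t) xq.
have h3 := hz t.
have -> : f z x - f z0 x = (f z x - f z (q t)) - (f z0 (q t) - f z (q t)) - (f z0 x - f z0 (q t)) by ring.
apply: le_trans (ler_normB _ _) _; apply: le_trans (lerD (ler_normB _ _) (lexx _)) _.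
lra.
Qed.

Lemma unif_contB (g h : pt R d -> R) : unif_cont g -> unif_cont h -> unif_cont (fun x => g x - h x).
Proof.
move=> ug uh e e0; have e20 : 0 < e / 2 by rewrite divr_gt0.
have [d1 d10 h1] := ug _ e20; have [d2 d20 h2] := uh _ e20.
exists (Num.min d1 d2); first by rewrite lt_min d10.
move=> x y xc yc xy; have -> : g x - h x - (g y - h y) = (g x - g y) - (h x - h y) by ring.
have k1 : `|g x - g y| <= e / 2.
  by apply: h1 => // i; have := xy i; rewrite lt_min => /andP[].
have k2 : `|h x - h y| <= e / 2.
  by apply: h2 => // i; have := xy i; rewrite lt_min => /andP[].
by apply: le_trans (ler_normB _ _) _; lra.
Qed.

(** The coefficient bound with no differences at all ([A] empty), applied to [g - h]; the factors
    (sqrt 2)^(-j) are at most 1. *)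
Lemma haar_coef_dist (n : 'I_d -> nat) (g h : pt R d -> R) (e : R) :
  (forall i, 0 < n i)%N -> unif_cont g -> unif_cont h ->
  (forall x, in_cube x -> `|g x - h x| <= e) -> `|haar_coef n g - haar_coef n h| <= e.
Proof.
move=> n0 ug uh gh.
have mw k : mb01 (haar_w n k : R -> R) by exact: mb01_haar_w.
have e0 : 0 <= e by apply: le_trans (gh _ (@cube0 R d)); exact: normr_ge0.
have -> : haar_coef n g - haar_coef n h = haar_coef n (fun x => g x - h x).
  rewrite /haar_coef !tensor_haar -mulN1r -cube_integralZ; last exact: iint_ok_tensor.
  rewrite -cube_integralD; [|exact: iint_ok_tensor|by apply/iint_okZ/iint_ok_tensor].
  by apply: cube_integral_eq => x _; rewrite /tensor; ring.
apply: le_trans (haar_coef_bound (A := pred0) (M := e) n0 (unif_contB ug uh) _ _) _ => //.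
  move=> us x _; rewrite filter_pred0; case: us => [|//] _ _ xc; exact: gh.
apply: ler_piMr => //; apply: prodr_ile1 => i _.
rewrite exprn_ge0 ?invr_ge0 ?sqrtr_ge0 //= exprn_ile1 ?invr_ge0 ?sqrtr_ge0 //.
by rewrite invf_le1 ?sqrt2_gt0 // -[leLHS]sqrtr1 ler_wsqrtr // ler1n.
Qed.

End Modulus.

(** * Simple Borel functions on the cube *)

Section SimpleFunctions.
Variables (R : realType) (d : nat).
Implicit Types (x y : pt R d) (b c : pt R d -> bool) (h g : pt R d -> R) (vs : seq R).

Definition bset b := [set x : pt R d | in_cube x /\ b x].
(** Borel sets as boolean predicates on the cube: level sets of simple functions then combine by
    boolean connectives. *)
Definition bor b : Prop := borel_cube (bset b).

Lemma bset_level h v : bset (fun x => h x == v) = cube (d := d) `&` h @^-1` [set v].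
Proof. by apply/seteqP; split => x /= [? /eqP ?]; split => //; apply/eqP. Qed.

Lemma bor_sigma : sigma_algebra (@cube R d) (@borel_cube R d).
Proof. exact: smallest_sigma_algebra. Qed.

Lemma bor_ext b c : (forall x, in_cube x -> b x = c x) -> bor b -> bor c.
Proof.
move=> bc; rewrite /bor (_ : bset c = bset b) //.
by apply/seteqP; split => x [xc]; rewrite ?bc // => ?; split => //; rewrite ?bc.
Qed.

Lemma bor_false : bor (fun=> false).
Proof.
rewrite /bor (_ : bset _ = set0); first by case: bor_sigma.
by apply/seteqP; split => // x [].
Qed.

Lemma bor_neg b : bor b -> bor (fun x => ~~ b x).
Proof.
have [_ hD _] := bor_sigma; move=> /hD; congr (borel_cube _).
apply/seteqP; split => x [xc /= h]; split => //.
  by apply/negP => bx; apply: h.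
by case=> _; apply/negP.
Qed.

Lemma bor_or b c : bor b -> bor c -> bor (fun x => b x || c x).
Proof.
have [_ _ hU] := bor_sigma; move=> hb hc.
rewrite /bor (_ : bset _ = \bigcup_n (if n == 0%N then bset b else bset c)).
  by apply: hU => n; case: ifP.
apply/seteqP; split => [x [xc /orP[bx|cx]]|x [n _]]; first by exists 0%N.
  by exists 1%N.
by case: ifP => _ [xc h]; split => //; rewrite h ?orbT.
Qed.

Lemma bor_and b c : bor b -> bor c -> bor (fun x => b x && c x).
Proof.
move=> /bor_neg hb /bor_neg hc; have /bor_neg := bor_or hb hc.
by apply: bor_ext => x _; rewrite negb_or !negbK.
Qed.

Lemma bor_true : bor (fun=> true). Proof. exact: bor_neg bor_false. Qed.

Lemma bor_has (T : Type) (s : seq T) (B : T -> pt R d -> bool) :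
  (forall i, bor (B i)) -> bor (fun x => has (B^~ x) s).
Proof.
move=> hB; elim: s => [|i s IH] /=; first exact: bor_false.
exact: bor_or.
Qed.

Lemma eucl_dist_coord x y (i : 'I_d) : `|x i - y i| <= eucl_dist x y.
Proof.
rewrite /eucl_dist -sqrtr_sqr ler_wsqrtr // (bigD1 i) //= lerDl.
by apply: sumr_ge0 => j _; exact: sqr_ge0.
Qed.

Lemma bor_open (b : pt R d -> bool) :
  (forall x, b x -> exists2 e : R, 0 < e & forall y, eucl_dist x y < e -> b y) -> bor b.
Proof.
move=> ob; apply: sub_sigma_algebra; exists [set x | b x]; first exact: ob.
by apply/seteqP; split.
Qed.

Lemma bor_lt (i : 'I_d) (a : R) : bor (fun x => x i < a).
Proof.
apply: bor_open => x xa; exists (a - x i); first by rewrite subr_gt0.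
by move=> y /(le_lt_trans (eucl_dist_coord _ _ i)); rewrite ltr_norml => /andP[]; lra.
Qed.

Lemma bor_gt (i : 'I_d) (a : R) : bor (fun x => a < x i).
Proof.
apply: bor_open => x xa; exists (x i - a); first by rewrite subr_gt0.
by move=> y /(le_lt_trans (eucl_dist_coord _ _ i)); rewrite ltr_norml => /andP[]; lra.
Qed.

Lemma bor_eq (i : 'I_d) (a : R) : bor (fun x => x i == a).
Proof.
have := bor_and (bor_neg (bor_lt i a)) (bor_neg (bor_gt i a)).
by apply: bor_ext => x _; rewrite -!leNgt eq_le andbC.
Qed.

Definition bsimple h := forall v, bor (fun x => h x == v).

Lemma simple_on_cubeP vs h :
  simple_on_cube vs h <-> (forall x, in_cube x -> h x \in vs) /\ bsimple h.
Proof.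
by split=> -[h1 h2]; split => // v; have := h2 v; rewrite /bor bset_level.
Qed.

Lemma bsimple_cst v : bsimple (fun=> v).
Proof.
by move=> w; case: eqP => _; [exact: bor_true|exact: bor_false].
Qed.

Lemma bsimple_if b h g : bor b -> bsimple h -> bsimple g ->
  bsimple (fun x => if b x then h x else g x).
Proof.
move=> bb hh hg v; have := bor_or (bor_and bb (hh v)) (bor_and (bor_neg bb) (hg v)).
by apply: bor_ext => x _; case: (b x); rewrite /= ?orbF.
Qed.

Lemma bsimple_op (op : R -> R -> R) vs ws h g :
  simple_on_cube vs h -> simple_on_cube ws g ->
  simple_on_cube [seq op v w | v <- vs, w <- ws] (fun x => op (h x) (g x)).
Proof.
rewrite !simple_on_cubeP => -[hv hs] [gw gs]; split.
  by move=> x xc; apply: allpairs_f; [exact: hv|exact: gw].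
move=> v; pose B v1 x := has (fun w => (h x == v1) && (g x == w) && (op v1 w == v)) ws.
have hB : bor (fun x => has (B^~ x) vs).
  apply: bor_has => v1; apply: bor_has => w; apply: bor_and.
    by apply: bor_and; [exact: hs|exact: gs].
  by case: (_ == _); [exact: bor_true|exact: bor_false].
apply: bor_ext hB => x xc; apply/hasP/eqP.
  by move=> [v1 _ /hasP[w _ /andP[/andP[/eqP -> /eqP ->] /eqP]]].
move=> e; exists (h x); first exact: hv.
by apply/hasP; exists (g x); [exact: gw|rewrite !eqxx e eqxx].
Qed.

Lemma simple_scale (c : R) vs h :
  simple_on_cube vs h -> simple_on_cube [seq c * v | v <- vs] (fun x => c * h x).
Proof.
move=> sh; have sc : simple_on_cube [:: c] (fun _ : pt R d => c).
  by apply/simple_on_cubeP; split; [move=> *; rewrite inE|exact: bsimple_cst].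
by have := bsimple_op *%R sc sh; rewrite /= cats0.
Qed.

Lemma haar_vals_mem n (t : R) : haar n t \in haar_vals R n.
Proof.
rewrite /haar /haar_vals; case: ifP => _; first by rewrite inE eqxx.
by do ![case: ifP => _]; rewrite !inE eqxx ?orbT.
Qed.

Lemma bsimple_haar n (i : 'I_d) : bsimple (fun x => haar n (x i)).
Proof.
rewrite /haar; case: (leqP n 1) => _; first exact: bsimple_cst.
cbv zeta; apply: bsimple_if; first by apply: bor_and; [exact: bor_gt|exact: bor_lt].
  exact: bsimple_cst.
apply: bsimple_if; first by apply: bor_and; [exact: bor_gt|exact: bor_lt].
  exact: bsimple_cst.
do ![apply: bsimple_if; first exact: bor_eq]; try exact: bsimple_cst.
Qed.

Lemma simple_haar_d (n : 'I_d -> nat) : simple_on_cube (haar_d_vals R n) (haar_d n).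
Proof.
apply/simple_on_cubeP; split.
  move=> x _; rewrite /haar_d /haar_d_vals.
  have idx s : exists t : 'I_6, nth 0 (haar_vals R (n s)) t = haar (n s) (x s).
    have /(nthP 0)[k k6 e] := haar_vals_mem (n s) (x s).
    by exists (Ordinal k6).
  have [t ht] := choice idx.
  rewrite -(eq_bigr _ (fun s _ => ht s)); apply/mapP.
  exists [ffun s => t s]; first by rewrite mem_enum.
  by apply: eq_bigr => s _; rewrite ffunE.
(* The induction over the factors produces a value list other than [haar_d_vals]; only the
   measurability of the level sets is kept from it. *)
have [vs svs] : exists vs, simple_on_cube vs (haar_d n : pt R d -> R).
  rewrite /haar_d; elim: (index_enum _) => [|s r [vs IH]].
    rewrite (_ : (fun x : pt R d => _) = fun=> 1); last first.
      by apply/funext => x; rewrite big_nil.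
    exists [:: 1]; apply/simple_on_cubeP.
    by split; [move=> *; rewrite inE|exact: bsimple_cst].
  rewrite (_ : (fun x : pt R d => _) =
    fun x => haar (n s) (x s) * \prod_(s <- r) haar (n s) (x s)); last first.
    by apply/funext => x; rewrite big_cons.
  have sh : simple_on_cube (haar_vals R (n s)) (fun x => haar (n s) (x s)).
    by apply/simple_on_cubeP; split; [move=> *; exact: haar_vals_mem|exact: bsimple_haar].
  by exists [seq v * w | v <- haar_vals R (n s), w <- vs]; exact: bsimple_op.
by have /simple_on_cubeP[] := svs.
Qed.

End SimpleFunctions.

(** * Random signs *)

Section RandomSigns.
Variable R : realType.
Implicit Types (b : seq bool) (xs : seq R).

Definition sgn (c : bool) : R := if c then 1 else -1.

Fixpoint signs n : seq (seq bool) :=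
  if n is m.+1 then map (cons true) (signs m) ++ map (cons false) (signs m) else [:: [::]].

Fixpoint sgnsum b xs : R :=
  match b, xs with c :: b', x :: xs' => sgn c * x + sgnsum b' xs' | _, _ => 0 end.

Lemma size_signs n : size (signs n) = (2 ^ n)%N.
Proof. by elim: n => //= n IH; rewrite size_cat !size_map IH expnS mul2n addnn. Qed.

Lemma sum_signsS (F : seq bool -> R) n : \sum_(b <- signs n.+1) F b =
  \sum_(b <- signs n) (F (true :: b) + F (false :: b)).
Proof. by rewrite /= big_cat !big_map big_split. Qed.

Lemma sum_signs_cst n (c : R) : \sum_(b <- signs n) c = 2 ^+ n * c.
Proof. by rewrite big_const_seq count_predT size_signs iter_addr_0 -[LHS]mulr_natl natrX. Qed.

Lemma signs_moment2 xs :
  \sum_(b <- signs (size xs)) sgnsum b xs ^+ 2 = 2 ^+ size xs * \sum_(x <- xs) x ^+ 2.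
Proof.
elim: xs => [|x xs IH]; first by rewrite /= big_seq1 big_nil expr0n mulr0.
rewrite [size _]/= sum_signsS big_cons /= exprS.
rewrite (eq_bigr (fun b => 2 * sgnsum b xs ^+ 2 + 2 * x ^+ 2)); last first.
  by move=> b _; rewrite /sgn; ring.
by rewrite big_split /= -mulr_sumr IH sum_signs_cst; ring.
Qed.

(** Khinchin's inequality for the exponent 4. Averaging over the first sign removes the odd powers
    and leaves S^4 + 6 x^2 S^2 + x^4, whose mean is at most 3 V^2 + 6 x^2 V + x^4 <= 3 (V +
    x^2)^2. *)
Lemma signs_moment4 xs :
  \sum_(b <- signs (size xs)) sgnsum b xs ^+ 4 <=
  2 ^+ size xs * (3 * (\sum_(x <- xs) x ^+ 2) ^+ 2).
Proof.
elim: xs => [|x xs IH]; first by rewrite /= big_seq1 big_nil !expr0n !mulr0.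
rewrite [size _]/= sum_signsS big_cons /= exprS.
rewrite (eq_bigr (fun b => 2 * sgnsum b xs ^+ 4 + 12 * x ^+ 2 * sgnsum b xs ^+ 2
  + 2 * x ^+ 4)); last by move=> b _; rewrite /sgn; ring.
rewrite !big_split /= -!mulr_sumr signs_moment2 sum_signs_cst.
set V := \sum_(x <- xs) _ in IH *; set N : R := 2 ^+ size xs in IH *.
have N0 : 0 <= N by rewrite exprn_ge0.
have x4 : 0 <= N * x ^+ 4 by rewrite mulr_ge0 // (_ : x ^+ 4 = (x ^+ 2) ^+ 2) ?sqr_ge0 // -exprM.
nra.
Qed.

(** The left side is (2s - V)(6V - s). It is negative for 2s < V, and its maximum, at s = 13V/4, is
    (121/8) V^2, just below 16 V^2. *)
Lemma parabola_le_indic (s V : R) : 0 <= s -> 0 < V ->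
  13 * s * V - 2 * s ^+ 2 - 6 * V ^+ 2 <= 16 * V ^+ 2 * (V <= 2 * s)%R%:R.
Proof.
move=> s0 V0; case: (leP V (2 * s)) => h; rewrite ?mulr1 ?mulr0.
  have : 0 <= 2 * (s - 13 / 4 * V) ^+ 2 + (22 - 169 / 8) * V ^+ 2.
    by rewrite addr_ge0 // mulr_ge0 ?sqr_ge0 //; lra.
  lra.
have : 0 <= (V - 2 * s) * (6 * V - s) by rewrite mulr_ge0 //; lra.
lra.
Qed.

(* Paley-Zygmund in polynomial form: the parabola vanishing at 1/2 and 6 minorizes
   a multiple of the indicator of [1/2, +oo[, and has positive mean because the
   second and fourth moments are [V] and at most [3 V ^+ 2]. *)
Lemma signs_anticoncentration xs (V := \sum_(x <- xs) x ^+ 2) : 0 < V ->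
  2 ^+ size xs <= 16 * \sum_(b <- signs (size xs)) (V <= 2 * sgnsum b xs ^+ 2)%R%:R :> R.
Proof.
move=> V0; set N : R := 2 ^+ size xs.
have key b : 13 * sgnsum b xs ^+ 2 * V - 2 * sgnsum b xs ^+ 4 - 6 * V ^+ 2
   <= 16 * V ^+ 2 * (V <= 2 * sgnsum b xs ^+ 2)%R%:R.
  have -> : sgnsum b xs ^+ 4 = (sgnsum b xs ^+ 2) ^+ 2 by rewrite -exprM.
  by apply: parabola_le_indic => //; exact: sqr_ge0.
have : \sum_(b <- signs (size xs)) (13 * sgnsum b xs ^+ 2 * V - 2 * sgnsum b xs ^+ 4 - 6 * V ^+ 2)
   <= \sum_(b <- signs (size xs)) (16 * V ^+ 2 * (V <= 2 * sgnsum b xs ^+ 2)%R%:R).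
  by apply: ler_sum => b _; exact: key.
rewrite !sumrB -!mulr_sumr -mulr_suml -mulr_sumr signs_moment2 sum_signs_cst -/V -/N.
have := signs_moment4 xs; rewrite -/V -/N; set S4 := \sum_(b <- _) _; set I := \sum_(b <- _) _.
move=> h4 h; have V20 : 0 < V ^+ 2 by rewrite exprn_gt0.
rewrite -(ler_pM2l V20); nra.
Qed.

End RandomSigns.

(** * Integrals of simple functions *)

Section StochasticIntegral.
Context {R : realType} {d : nat} {dO : measure_display} {Omega : measurableType dO}.
Variables (P : probability Omega R) (mu : set (pt R d) -> Omega -> R).
Hypothesis smu : stoch_measure P mu.
Implicit Types (x : pt R d) (b c : pt R d -> bool) (h g : pt R d -> R) (vs ws : seq R).

Definition smeas b : Omega -> R := mu (bset b).

Lemma bset_ext b c : (forall x, in_cube x -> b x = c x) -> bset b = bset c.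
Proof.
by move=> bc; apply/seteqP; split => x [xc h]; split => //; rewrite ?bc // -bc.
Qed.

Lemma smeas_measurable b : bor b -> measurable_fun setT (smeas b).
Proof. by case: smu => hm _ _; exact: hm. Qed.

Lemma smeas_or b c : bor b -> bor c -> (forall x, in_cube x -> b x -> ~~ c x) ->
  {ae P, forall w, smeas (fun x => b x || c x) w = smeas b w + smeas c w}.
Proof.
move=> hb hc bc; have [_ hA _] := smu; have := hA _ _ hb hc.
rewrite (_ : bset b `&` bset c = set0); last first.
  apply/seteqP; split => // x [[xc bx] [_ cx]]; have := bc x xc bx.
  by rewrite cx.
move=> /(_ erefl); rewrite /smeas (_ : bset b `|` bset c = bset (fun x => b x || c x)) //.
apply/seteqP; split => x; first by move=> [[xc bx]|[xc cx]]; split => //=; rewrite ?bx ?cx ?orbT.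
by move=> [xc /orP[?|?]]; [left|right].
Qed.

(** The empty set is disjoint from itself, so additivity gives mu(empty) = 2 mu(empty). *)
Lemma smeas_false : {ae P, forall w, smeas (fun=> false) w = 0}.
Proof.
have := smeas_or (@bor_false R d) (@bor_false R d) (fun _ _ _ => isT).
by apply: filterS => w /= /eqP; rewrite -subr_eq0 opprD addrA subrr sub0r oppr_eq0 => /eqP.
Qed.

Lemma smeas_ext b c : (forall x, in_cube x -> b x = c x) -> smeas b = smeas c.
Proof. by move=> e; rewrite /smeas (bset_ext e). Qed.

Lemma smeas_partition b g ws : bor b -> bsimple g -> uniq ws ->
  {ae P, forall w, smeas (fun x => b x && (g x \in ws)) w =
     \sum_(v <- ws) smeas (fun x => b x && (g x == v)) w}.
Proof.
move=> hb hg; elim: ws => [|v ws IH] /=.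
  move=> _; apply: filterS smeas_false => w <-; rewrite big_nil.
  by rewrite (smeas_ext (c := fun=> false)) // => x _; rewrite in_nil andbF.
move=> /andP[vws /IH {}IH].
have h1 : bor (fun x => b x && (g x == v)) by exact: bor_and.
have h2 : bor (fun x => b x && (g x \in ws)).
  apply: bor_and => //; have := bor_has ws (fun v => hg v).
  by apply: bor_ext => x _; rewrite -has_pred1; apply: eq_has => y /=; rewrite eq_sym.
have dis x : in_cube x -> b x && (g x == v) -> ~~ (b x && (g x \in ws)).
  by move=> _ /andP[_ /eqP ->]; rewrite negb_and vws orbT.
apply: filterS2 (smeas_or h1 h2 dis) IH => w e1 e2; rewrite big_cons -e2 -e1.
by rewrite (smeas_ext (c := fun x => b x && (g x == v) || b x && (g x \in ws))) // => x _; rewrite inE andb_orr.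
Qed.

(** Each instance of additivity has its own null set; the finitely many needed for one identity are
    merged here. *)
Lemma ae_all (T : eqType) (s : seq T) (Q : T -> Omega -> Prop) :
  (forall i, {ae P, forall w, Q i w}) -> {ae P, forall w, forall i, i \in s -> Q i w}.
Proof.
move=> hQ; elim: s => [|i s IH]; first exact: aeW.
apply: filterS2 (hQ i) IH => w Qi IH j; rewrite inE => /orP[/eqP -> //|]; exact: IH.
Qed.

Lemma sintE vs h w : sint mu vs h w = \sum_(v <- undup vs) v * smeas (fun x => h x == v) w.
Proof. by apply: eq_bigr => v _; rewrite /smeas bset_level. Qed.

Lemma sint_refine vs ws h g : simple_on_cube vs h -> simple_on_cube ws g ->
  {ae P, forall w, sint mu vs h w = \sum_(v <- undup vs) \sum_(a <- undup ws)
     v * smeas (fun x => (h x == v) && (g x == a)) w}.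
Proof.
move=> /simple_on_cubeP[hv hs] /simple_on_cubeP[gw gs].
have := ae_all (undup vs) (fun v => smeas_partition (hs v) gs (undup_uniq ws)).
apply: filterS => w e; rewrite sintE big_seq [RHS]big_seq.
apply: eq_bigr => v vin; rewrite -mulr_sumr -e //; congr (_ * _).
rewrite (smeas_ext (c := fun x => (h x == v) && (g x \in undup ws))) // => x xc.
by rewrite mem_undup gw // andbT.
Qed.

Lemma smeas_null b : (forall x, in_cube x -> ~~ b x) -> {ae P, forall w, smeas b w = 0}.
Proof.
move=> nb; rewrite (smeas_ext (c := fun=> false)); first exact: smeas_false.
by move=> x /nb/negbTE.
Qed.

(** All integrals are computed on the common refinement of the level sets of [h] and [g]. Taking
    [op] to be a projection refines [h] or [g] itself, so linearity reduces to identities between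
    finite sums. *)
Lemma sint_op (op : R -> R -> R) vs ws us h g k :
  simple_on_cube vs h -> simple_on_cube ws g -> simple_on_cube us k ->
  (forall x, in_cube x -> k x = op (h x) (g x)) ->
  {ae P, forall w, sint mu us k w = \sum_(v <- undup vs) \sum_(a <- undup ws)
     op v a * smeas (fun x => (h x == v) && (g x == a)) w}.
Proof.
move=> sh sg sk kop; have /simple_on_cubeP[hv hs] := sh.
have /simple_on_cubeP[gw gs] := sg; have /simple_on_cubeP[ku ks] := sk.
have e1 := sint_refine sk sh.
have e2 := ae_all (allpairs pair (undup us) (undup vs))
  (fun p => smeas_partition (bor_and (ks p.1) (hs p.2)) gs (undup_uniq ws)).
have e3 := ae_all (allpairs pair (undup vs) (undup ws))
  (fun p => smeas_partition (bor_and (hs p.1) (gs p.2)) ks (undup_uniq us)).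
(* Cells on which the value of [k] is incompatible with those of [h] and [g] are empty. In the
   others the value [a] may be replaced by [op v u], and then the sum over [a] collapses. *)
have e4 : {ae P, forall w, forall t, t \in allpairs pair (allpairs pair (undup us) (undup vs)) (undup ws) ->
   t.1.1 != op t.1.2 t.2 -> smeas (fun x => (k x == t.1.1) && (h x == t.1.2) && (g x == t.2)) w = 0}.
  apply: ae_all => -[[a v] u] /=.
  have [->|ne] := eqVneq a (op v u); first by apply: aeW.
  have : {ae P, forall w, smeas (fun x => (k x == a) && (h x == v) && (g x == u)) w = 0}.
    apply: smeas_null => x xc; apply: contra ne => /andP[/andP[/eqP <- /eqP <-] /eqP <-].
    by rewrite kop.
  by apply: filterS => w ->.
apply: filterS2 (filterI e1 e2) (filterI e3 e4) => w [-> h2] [h3 h4].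
transitivity (\sum_(a <- undup us) \sum_(v <- undup vs) \sum_(u <- undup ws)
   op v u * smeas (fun x => (k x == a) && (h x == v) && (g x == u)) w).
  rewrite big_seq [RHS]big_seq; apply: eq_bigr => a ain.
  rewrite big_seq [RHS]big_seq; apply: eq_bigr => v vin.
  rewrite (smeas_ext (c := fun x => (k x == a) && (h x == v) && (g x \in undup ws))); last first.
    by move=> x xc; rewrite mem_undup gw // andbT.
  rewrite (h2 (a, v)); last by apply: allpairs_f.
  rewrite mulr_sumr big_seq [RHS]big_seq; apply: eq_bigr => u uin.
  have [->//|ne] := eqVneq a (op v u).
  rewrite (h4 (a, v, u)) ?mulr0 //.
  by apply: allpairs_f => //; exact: allpairs_f.
rewrite exchange_big /= big_seq [RHS]big_seq; apply: eq_bigr => v vin.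
rewrite exchange_big /= big_seq [RHS]big_seq; apply: eq_bigr => u uin.
rewrite -mulr_sumr; congr (_ * _).
rewrite [RHS](_ : _ = smeas (fun x => (h x == v) && (g x == u) && (k x \in undup us)) w); last first.
  by congr (_ _); apply: smeas_ext => x xc; rewrite mem_undup ku // andbT.
rewrite (h3 (v, u)); last by apply: allpairs_f.
apply: eq_bigr => a _; congr (_ _); apply: smeas_ext => x _.
by rewrite [RHS]andbC andbA.
Qed.

Lemma sintD vs ws us h g k :
  simple_on_cube vs h -> simple_on_cube ws g -> simple_on_cube us k ->
  (forall x, in_cube x -> k x = h x + g x) ->
  {ae P, forall w, sint mu us k w = sint mu vs h w + sint mu ws g w}.
Proof.
move=> sh sg sk kop.
have e1 := sint_op sh sg sk kop.
have e2 := sint_op (op := fun v _ => v) sh sg sh (fun x _ => erefl).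
have e3 := sint_op (op := fun _ a => a) sh sg sg (fun x _ => erefl).
apply: filterS2 e1 (filterI e2 e3) => w -> [-> ->].
rewrite -big_split; apply: eq_bigr => v _; rewrite -big_split; apply: eq_bigr => a _.
exact: mulrDl.
Qed.

Lemma sintZ (c : R) vs us h k :
  simple_on_cube vs h -> simple_on_cube us k ->
  (forall x, in_cube x -> k x = c * h x) ->
  {ae P, forall w, sint mu us k w = c * sint mu vs h w}.
Proof.
move=> sh sk kop.
have e1 := sint_op (op := fun v _ => c * v) sh sh sk kop.
have e2 := sint_op (op := fun v _ => v) sh sh sh (fun x _ => erefl).
apply: filterS2 e1 e2 => w -> ->; rewrite mulr_sumr; apply: eq_bigr => v _.
by rewrite mulr_sumr; apply: eq_bigr => a _; rewrite mulrA.
Qed.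

Lemma sint_measurable vs h : simple_on_cube vs h -> measurable_fun setT (sint mu vs h).
Proof.
move=> /simple_on_cubeP[_ hs].
rewrite (_ : sint mu vs h = fun w => \sum_(v <- undup vs) v * smeas (fun x => h x == v) w).
  apply: measurable_sum => v; apply: measurable_funM => //.
  exact: smeas_measurable.
by apply/funext => w; rewrite sintE.
Qed.

Lemma simple_lincomb (T : eqType) (s : seq T) (c : T -> R) (n : T -> 'I_d -> nat) :
  exists vs, simple_on_cube vs (fun x : pt R d => \sum_(i <- s) c i * haar_d (n i) x) /\
  {ae P, forall w, sint mu vs (fun x => \sum_(i <- s) c i * haar_d (n i) x) w =
     \sum_(i <- s) c i * haar_int mu (n i) w}.
Proof.
elim: s => [|i s [vs [svs IH]]].
  rewrite (_ : (fun x => _) = fun=> 0); last by apply/funext => x; rewrite big_nil.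
  exists [:: 0]; have s0 : simple_on_cube [:: 0] (fun _ : pt R d => 0 : R).
    by apply/simple_on_cubeP; split; [move=> *; rewrite inE|exact: bsimple_cst].
  split=> //; apply: aeW => w; rewrite big_nil sintE /= big_seq1 mul0r //.
have si := simple_scale (c i) (@simple_haar_d R d (n i)).
have ss := bsimple_op +%R si svs.
rewrite (_ : (fun x => _) = fun x => c i * haar_d (n i) x + \sum_(j <- s) c j * haar_d (n j) x); last first.
  by apply/funext => x; rewrite big_cons.
eexists; split; first exact: ss.
have e1 := sintD si svs ss (fun x _ => erefl).
have e2 := sintZ (@simple_haar_d R d (n i)) si (fun x _ => erefl).
apply: filterS2 e1 (filterI e2 IH) => w -> [-> ->].
by rewrite big_cons.
Qed.

End StochasticIntegral.

(** * Boundedness in probability *)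

Section Probability.
Context {R : realType} {dO : measure_display} {Omega : measurableType dO}.
Variable P : probability Omega R.

Definition pr (A : set Omega) : R := fine (P A).

Lemma prE A : measurable A -> P A = (pr A)%:E.
Proof. by move=> mA; rewrite /pr fineK // fin_num_measure. Qed.

Lemma pr_ge0 A : measurable A -> 0 <= pr A.
Proof. by move=> mA; rewrite -lee_fin -prE. Qed.

Lemma pr_le A B : measurable A -> measurable B -> {ae P, forall w, A w -> B w} -> pr A <= pr B.
Proof.
move=> mA mB [N [mN N0 hN]]; rewrite -lee_fin -!prE //.
have AB : A `<=` B `|` N.
  move=> w Aw; have [Bw|nBw] := pselect (B w); [by left|right].
  by apply: hN => /= h; apply: nBw; exact: h.
apply: (@le_trans _ _ (P (B `|` N))).
  by apply: le_measure => //; rewrite inE //; exact: measurableU.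
by apply: le_trans (measureU2 _ mB mN) _; rewrite [X in (_ + X <= _)%E](_ : _ = 0%E) ?adde0.
Qed.

Lemma prU A B : measurable A -> measurable B -> pr (A `|` B) <= pr A + pr B.
Proof.
move=> mA mB; rewrite -lee_fin EFinD -!prE //; first exact: measureU2.
exact: measurableU.
Qed.

(** Integration of an inequality between counting functions. Lists allow repetitions, which is how
    an integer factor such as 16 is encoded. *)
Lemma sum_pr_le (T S : Type) (s : seq T) (t : seq S) (A : T -> set Omega) (B : S -> set Omega) :
  (forall i, measurable (A i)) -> (forall j, measurable (B j)) ->
  (forall w, \sum_(i <- s) \1_(A i) w <= \sum_(j <- t) \1_(B j) w :> R) ->
  \sum_(i <- s) pr (A i) <= \sum_(j <- t) pr (B j).
Proof.
move=> mA mB AB.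
have int (U : Type) (r : seq U) (C : U -> set Omega) : (forall i, measurable (C i)) ->
    (\int[P]_w (\sum_(i <- r) (\1_(C i) w)%:E) = (\sum_(i <- r) pr (C i))%:E)%E.
  move=> mC; rewrite ge0_integral_sum //.
  - rewrite -sumEFin; apply: eq_bigr => i _.
    by rewrite integral_indic // setIT; exact: prE.
  - by move=> i; apply/measurable_EFinP; exact: measurable_indic.
rewrite -lee_fin -!int //; apply: ge0_le_integral => //.
- by move=> w _; apply: sume_ge0 => i _; rewrite lee_fin indicE ler0n.
- by apply: emeasurable_sum => i; apply/measurable_EFinP; exact: measurable_indic.
- by apply: emeasurable_sum => i; apply/measurable_EFinP; exact: measurable_indic.
by move=> w _; rewrite !sumEFin lee_fin.
Qed.

Lemma measurable_ge (X : Omega -> R) (a : R) : measurable_fun setT X ->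
  measurable [set w | a <= X w].
Proof.
move=> mX; rewrite -[X in measurable X]setTI.
exact: (measurable_fun_le measurableT (measurable_cst a) mX).
Qed.

Lemma measurable_normB (X Y : Omega -> R) : measurable_fun setT X -> measurable_fun setT Y ->
  measurable_fun setT (fun w => `|X w - Y w|).
Proof. by move=> mX mY; apply: measurableT_comp => //; exact: measurable_funB. Qed.

Lemma conv_prob_small (X : nat -> Omega -> R) (Y : Omega -> R) (e del : R) :
  conv_prob P X Y -> 0 < e -> 0 < del ->
  \forall m \near \oo, pr [set w | e <= `|X m w - Y w|] < del.
Proof.
move=> XY e0 del0; have := XY e e0 => /fine_cvgP[_] /cvgrPdist_lt /(_ _ del0).
apply: filterS => m /=; rewrite sub0r normrN => /(le_lt_trans (ler_norm _)); exact.
Qed.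

Lemma pr_eq0_negligible A : measurable A -> (forall e : R, 0 < e -> pr A <= e) ->
  P.-negligible A.
Proof.
move=> mA hA; apply/negligibleP => //; apply: etrans (prE mA) _; congr EFin.
apply/eqP; rewrite eq_le pr_ge0 // andbT leNgt; apply/negP => A0.
have := hA _ (divr_gt0 A0 (ltr0n R 2)); lra.
Qed.

(** If [L w] differs from [Y w], then from some rank on [X] stays at distance at least 1/(k+1) from
    [Y], for some k. The event [B k m] that this happens from rank m on lies in single events of
    arbitrarily small probability, so no subsequence has to be extracted. *)
Lemma conv_prob_ae_unique (X : nat -> Omega -> R) (Y L : Omega -> R) :
  (forall m, measurable_fun setT (X m)) -> measurable_fun setT Y ->
  conv_prob P X Y -> {ae P, forall w, (fun m => X m w) @ \oo --> L w} ->
  {ae P, forall w, L w = Y w}.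
Proof.
move=> mX mY XY XL.
pose B k m := \bigcap_i [set w | k.+1%:R^-1 <= `|X (m + i)%N w - Y w|].
have mS k m : measurable [set w | (k.+1%:R^-1 : R) <= `|X m w - Y w|].
  by apply: measurable_ge; exact: measurable_normB.
have mB k m : measurable (B k m) by apply: bigcapT_measurable => i; exact: mS.
have nB k m : P.-negligible (B k m).
  apply: pr_eq0_negligible => // e e0.
  have k0 : 0 < k.+1%:R^-1 :> R by rewrite invr_gt0.
  have [M _ hM] := conv_prob_small XY k0 e0.
  apply: le_trans (ltW (hM (m + M)%N (leq_addl _ _))).
  by apply: pr_le => //; apply: aeW => w /(_ M I).
have nU : P.-negligible (\bigcup_k \bigcup_m B k m).
  by apply: negligible_bigcup => k; exact: negligible_bigcup.
have nU' : {ae P, forall w, ~ (\bigcup_k \bigcup_m B k m) w}.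
  by apply: (negligibleS _ nU) => w /= /contrapT.
apply: filterS2 XL nU' => w XLw nw; have [//|LY] := eqVneq (L w) (Y w); exfalso.
have LY0 : 0 < `|L w - Y w| / 2 by rewrite divr_gt0 // normr_gt0 subr_eq0.
apply: nw; pose k := Num.trunc ((`|L w - Y w| / 2)^-1); exists k => //.
have hk : k.+1%:R^-1 <= `|L w - Y w| / 2.
  by rewrite invf_ple ?posrE // ltW // truncnS_gt.
move/cvgrPdist_lt : XLw => /(_ _ LY0) [m _ hm]; exists m => // i _ /=.
apply: le_trans hk _; have := hm (m + i)%N (leq_addr _ _) => /= h.
have := ler_distD (X (m + i)%N w) (L w) (Y w); lra.
Qed.

End Probability.

Section Boundedness.
Context {R : realType} {d : nat} {dO : measure_display} {Omega : measurableType dO}.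
Variables (P : probability Omega R) (mu : set (pt R d) -> Omega -> R).
Hypothesis smu : stoch_measure P mu.
Variables (g0 : pt R d -> R) (xi : Omega -> R).
Hypotheses (ug0 : unif_cont g0) (hxi : stoch_integral P mu g0 xi).

Lemma haar_psum_simple K g : exists vs, simple_on_cube vs (haar_psum K g : pt R d -> R) /\
  {ae P, forall w, sint mu vs (haar_psum K g) w = int_haar_psum mu K g w}.
Proof.
exact: (simple_lincomb smu (index_enum {ffun 'I_d -> 'I_(2 ^ K)})
  (fun t => haar_coef (fun s => (t s).+1) g) (fun t s => (t s).+1)).
Qed.

Lemma haar_psum_unif (g : pt R d -> R) (e : R) : unif_cont g -> 0 < e ->
  \forall K \near \oo, forall x, in_cube x -> `|haar_psum K g x - g x| < e.
Proof.
move=> ug e0; have e20 : 0 < e / 2 by rewrite divr_gt0.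
have [del del0 hd] := ug _ e20.
have : (fun K => (2^-1 : R) ^+ K) @ \oo --> (0 : R).
  by apply: cvg_expr; rewrite ger0_norm ?invr_ge0 // invf_lt1 // ltr1n.
move=> /cvgrPdist_lt /(_ _ del0); apply: filterS => K.
rewrite sub0r normrN ger0_norm ?exprn_ge0 ?invr_ge0 // => hK x xc.
apply: le_lt_trans (_ : e / 2 < e); last by lra.
apply: (haar_psum_approx (del := del)) => //; last exact: ltW.
by move=> y yc; exact: hd.
Qed.

(* If integrals of simple functions bounded by 1 were unbounded in probability, small
   multiples [u m] of them would tend to 0 uniformly; then [h m] and [h m + u m] both
   approximate [g0], so the integrals of [u m] must tend to 0. *)
Lemma sint_bounded_prob (del : R) : 0 < del -> exists2 C : R, 0 < C &
  forall vs g, simple_on_cube vs g -> (forall x, in_cube x -> `|g x| <= 1) ->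
    pr P [set w | C <= `|sint mu vs g w|] <= del.
Proof.
move=> del0; apply: contrapT => hC.
have bad m : exists p : seq R * (pt R d -> R), [/\ simple_on_cube p.1 p.2,
    (forall x, in_cube x -> `|p.2 x| <= 1) &
    del < pr P [set w | m.+1%:R <= `|sint mu p.1 p.2 w|]].
  apply: contrapT => nb; apply: hC; exists m.+1%:R; first by rewrite ltr0n.
  move=> vs g svs g1; rewrite leNgt; apply/negP => h; apply: nb.
  by exists (vs, g).
have [p hp] := choice bad.
have [vs hvs] := choice (fun K => haar_psum_simple K g0).
pose h K : pt R d -> R := haar_psum K g0.
pose u m x : R := m.+1%:R^-1 * (p m).2 x.
pose us m := [seq m.+1%:R^-1 * v | v <- (p m).1].
have su m : simple_on_cube (us m) (u m) by apply: simple_scale; have [] := hp m.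
have sh m : simple_on_cube (vs m) (h m) by have [] := hvs m.
pose ws m := [seq a + b | a <- vs m, b <- us m].
have sw m : simple_on_cube (ws m) (fun x => h m x + u m x) by exact: (bsimple_op +%R).
have [mxi cxi] := hxi.
have c1 : conv_prob P (fun m => sint mu (vs m) (h m)) xi.
  by apply: cxi => // e e0; exact: haar_psum_unif.
have c2 : conv_prob P (fun m => sint mu (ws m) (fun x => h m x + u m x)) xi.
  apply: cxi => // e e0; have e20 : 0 < e / 2 by rewrite divr_gt0.
  have := near_infty_natSinv_lt (PosNum e20).
  apply: filterS2 (haar_psum_unif ug0 e20) => m h1 /= h2 x xc.
  rewrite addrAC [e]splitr (le_lt_trans (ler_normD _ _)) // ltrD ?h1 //.
  rewrite /u normrM ger0_norm ?invr_ge0 //; apply: le_lt_trans h2.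
  by rewrite ler_piMr ?invr_ge0 //; have [_ + _] := hp m; exact.
have del20 : 0 < del / 2 by rewrite divr_gt0.
have h20 : 0 < 2^-1 :> R by rewrite invr_gt0.
have [m1 _ hm1] := conv_prob_small c1 h20 del20.
have [m2 _ hm2] := conv_prob_small c2 h20 del20.
pose m := maxn m1 m2; have [sp _ hdel] := hp m; move: hdel; apply/negP; rewrite -leNgt.
have mint ts t : simple_on_cube ts t -> measurable_fun setT (sint mu ts t).
  exact: (sint_measurable smu).
set A := [set w | 2^-1 <= `|sint mu (vs m) (h m) w - xi w|].
set B := [set w | 2^-1 <= `|sint mu (ws m) (fun x => h m x + u m x) w - xi w|].
have mA : measurable A by apply/measurable_ge/measurable_normB => //; exact: mint.
have mB : measurable B by apply/measurable_ge/measurable_normB => //; exact: mint.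
have pA : pr P A < del / 2 by apply: hm1; rewrite /= leq_maxl.
have pB : pr P B < del / 2 by apply: hm2; rewrite /= leq_maxr.
apply: (@le_trans _ _ (pr P (A `|` B))); last by have := prU P mA mB; lra.
apply: pr_le.
- apply: measurable_ge; apply: measurableT_comp => //; exact: mint.
- exact: measurableU.
have e1 := sintD smu (sh m) (su m) (sw m) (fun x _ => erefl).
have e2 := sintZ smu sp (su m) (fun x _ => erefl).
apply: filterS2 e1 e2 => w e1 e2 /=; rewrite /A /B /= e1 e2 => hw.
have m0 : 0 < m.+1%:R :> R by rewrite ltr0n.
set a := sint mu (vs m) _ w; set b := m.+1%:R^-1 * _.
have b1 : 1 <= `|b| by rewrite normrM ger0_norm ?invr_ge0 // ler_pdivlMl // mulr1.
apply: contrapT => /not_orP[/negP + /negP]; rewrite -!ltNge => k1 k2.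
have : `|b| <= `|a + b - xi w| + `|a - xi w|.
  by rewrite -[b in X in X <= _](_ : (a + b - xi w) - (a - xi w) = b); [exact: ler_normB|ring].
lra.
Qed.

End Boundedness.

(** * Square sums of integrals of Haar functions *)

Section BoxSums.
Variables (R : realType) (d : nat).
Implicit Types (F : ('I_d -> nat) -> R).

Definition boxsum K F : R := \sum_(t : {ffun 'I_d -> 'I_(2 ^ K)}) F (fun s => (t s).+1).

(** Boxes of different size are indexed by different types; embedding the small one in the large one
    makes their sums comparable. *)
Lemma boxsum_widen K K' F : (K <= K')%N -> boxsum K F =
  \sum_(t : {ffun 'I_d -> 'I_(2 ^ K')} | [forall s, (t s < 2 ^ K)%N]) F (fun s => (t s).+1).
Proof.
move=> KK'; have le2 : (2 ^ K <= 2 ^ K')%N by rewrite leq_exp2l.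
have pos : (0 < 2 ^ K)%N by rewrite expn_gt0.
pose h (t : {ffun 'I_d -> 'I_(2 ^ K)}) : {ffun 'I_d -> 'I_(2 ^ K')} :=
  [ffun s => widen_ord le2 (t s)].
pose h' (t : {ffun 'I_d -> 'I_(2 ^ K')}) : {ffun 'I_d -> 'I_(2 ^ K)} :=
  [ffun s => insubd (Ordinal pos) (val (t s))].
rewrite (reindex h) /=; last first.
  have hv m : (m < 2 ^ K)%N -> nat_of_ord (insubd (Ordinal pos) m) = m.
    by move=> mK; rewrite -[LHS]/(val _) val_insubd mK.
  exists h' => t ht; apply/ffunP => s; rewrite !ffunE; apply: val_inj => /=; rewrite hv //.
  by move: ht; rewrite inE => /forallP.
apply: eq_big => [t|t _]; first by apply/esym/forallP => s; rewrite ffunE /= ltn_ord.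
by congr F; apply/funext => s; rewrite ffunE.
Qed.

Lemma boxsum_mono K K' F : (K <= K')%N -> (forall n, 0 <= F n) -> boxsum K F <= boxsum K' F.
Proof.
move=> KK' F0; rewrite (boxsum_widen F KK') /boxsum.
rewrite [leRHS](bigID (fun t : {ffun 'I_d -> 'I_(2 ^ K')} => [forall s, (t s < 2 ^ K)%N])) /=.
by rewrite lerDl; apply: sumr_ge0 => t _; exact: F0.
Qed.

Lemma boxsum_prod K (w : 'I_d -> nat -> R) :
  boxsum K (fun n => \prod_(s < d) w s (n s)) = \prod_(s < d) \sum_(0 <= n < 2 ^ K) w s n.+1.
Proof.
under eq_bigr do rewrite big_mkord.
by rewrite bigA_distr_bigA.
Qed.

End BoxSums.

(** * Almost sure square summability by randomized signs *)

Section SquareSums.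
Context {R : realType} {d : nat} {dO : measure_display} {Omega : measurableType dO}.
Variables (P : probability Omega R) (mu : set (pt R d) -> Omega -> R).
Hypothesis smu : stoch_measure P mu.
Variables (g0 : pt R d -> R) (xi : Omega -> R).
Hypotheses (ug0 : unif_cont g0) (hxi : stoch_integral P mu g0 xi).
Variable rho : R.
Hypothesis rho01 : 0 <= rho < 1.

Definition lamd (n : 'I_d -> nat) : R := \prod_(s < d) lam rho (n s).

(** The d-th power of the one-dimensional bound on the weighted sum of |chi_n|. Dividing by it makes
    all signed sums bounded by 1. *)
Definition haar_mass : R := (1 + (1 - rho)^-1) ^+ d.

Lemma haar_mass_gt0 : 0 < haar_mass.
Proof.
have /andP[r0 r1] := rho01; rewrite exprn_gt0 // ltr_pwDl // invr_ge0; lra.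
Qed.

Lemma lam_ge0 n : 0 <= lam rho n.
Proof.
by have /andP[r0 r1] := rho01; rewrite mulr_ge0 ?exprn_ge0 ?invr_ge0 ?sqrtr_ge0.
Qed.

Lemma lamd_ge0 n : 0 <= lamd n.
Proof. by apply: prodr_ge0 => s _; exact: lam_ge0. Qed.

Lemma boxsum_lamd_haar K (x : pt R d) : in_cube x ->
  boxsum K (fun n => lamd n * `|haar_d n x|) <= haar_mass.
Proof.
move=> xc; have -> : (fun n => lamd n * `|haar_d n x|) =
    (fun n => \prod_(s < d) (lam rho (n s) * `|haar (n s) (x s)|)).
  by apply/funext => n; rewrite big_split normr_prod.
rewrite (boxsum_prod K (fun s m => lam rho m * `|haar m (x s)|)) /haar_mass.
rewrite -[X in _ <= _ ^+ X]card_ord -prodr_const; apply: ler_prod => s _.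
rewrite (sum_lam_haar K rho01 (xc s)) andbT; apply: sumr_ge0 => m _.
by rewrite mulr_ge0 // lam_ge0.
Qed.

Lemma size_mem_signs n b : b \in signs n -> size b = n.
Proof.
elim: n b => [|n IH] b /=; first by rewrite inE => /eqP ->.
by rewrite mem_cat => /orP[] /mapP[b' /IH <- ->].
Qed.

Lemma sgnsum_zip (T : Type) (s : seq T) (X : T -> R) b :
  \sum_(p <- zip s b) sgn R p.2 * X p.1 = sgnsum b (map X s).
Proof.
elim: s b => [|i s IH] [|c b] //=; rewrite ?big_nil //.
by rewrite big_cons IH.
Qed.

Definition xterm (w : Omega) (n : 'I_d -> nat) : R := lamd n / haar_mass * haar_int mu n w.

Definition idx K (t : {ffun 'I_d -> 'I_(2 ^ K)}) (i : 'I_d) : nat := (t i).+1.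

Definition xterms K w : seq R := [seq xterm w (idx t) | t <- index_enum {ffun 'I_d -> 'I_(2 ^ K)}].

(** For fixed signs the sum is almost surely the integral of one simple function bounded by 1. *)
Lemma sgnsum_bounded (del C : R) K b : 
  (forall vs g, simple_on_cube vs g -> (forall x, in_cube x -> `|g x| <= 1) ->
    pr P [set w | C <= `|sint mu vs g w|] <= del) ->
  size b = size (index_enum {ffun 'I_d -> 'I_(2 ^ K)}) ->
  measurable [set w | C <= `|sgnsum b (xterms K w)|] /\
  pr P [set w | C <= `|sgnsum b (xterms K w)|] <= del.
Proof.
set s := index_enum _; pose n := @idx K; move=> hC sb.
have [vs [svs aes]] := simple_lincomb smu (zip s b)
  (fun p => sgn R p.2 * (lamd (n p.1) / haar_mass)) (fun p => n p.1).
set g := (fun x : pt R d => _) in svs aes.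
have g1 x : in_cube x -> `|g x| <= 1.
  move=> xc; apply: le_trans (ler_norm_sum _ _ _) _.
  rewrite (eq_bigr (fun p => (lamd (n p.1) / haar_mass) * `|haar_d (n p.1) x|)); last first.
    move=> p _; rewrite !normrM; congr (_ * _).
    rewrite (_ : `|sgn R p.2| = 1); last by rewrite /sgn; case: p.2; rewrite ?normrN normr1.
    by rewrite mul1r !ger0_norm ?invr_ge0 ?(ltW haar_mass_gt0) ?lamd_ge0.
  rewrite -(big_map fst xpredT (fun t => lamd (n t) / haar_mass * `|haar_d (n t) x|)).
  rewrite -/(unzip1 _) unzip1_zip ?sb //.
  rewrite (eq_bigr (fun t => haar_mass^-1 * (lamd (n t) * `|haar_d (n t) x|))); last first.
    by move=> t _; rewrite mulrAC mulrC mulrA.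
  rewrite -mulr_sumr ler_pdivrMl ?haar_mass_gt0 // mulr1.
  exact: boxsum_lamd_haar.
have E w : sgnsum b (xterms K w) =
    \sum_(p <- zip s b) sgn R p.2 * (lamd (n p.1) / haar_mass) * haar_int mu (n p.1) w.
  by rewrite -sgnsum_zip; apply: eq_bigr => p _; rewrite /xterm mulrA.
have mE : measurable_fun setT (fun w => sgnsum b (xterms K w)).
  rewrite (funext E); apply: measurable_sum => p; apply: measurable_funM => //.
  exact: (sint_measurable smu (@simple_haar_d R d _)).
have m1 : measurable [set w | C <= `|sgnsum b (xterms K w)|].
  by apply: measurable_ge; exact: measurableT_comp.
split=> //; apply: le_trans (hC _ _ svs g1); apply: pr_le => //.
  by apply: measurable_ge; apply: measurableT_comp => //; exact: (sint_measurable smu svs).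
by apply: filterS aes => w /= ->; rewrite E.
Qed.

(* Random signs: each signed sum exceeds [C] with probability at most [del], and the
   square sum is large only where at least 1/16 of the signed sums are. *)
Lemma square_sum_prob (del C : R) K : 0 < C ->
  (forall vs g, simple_on_cube vs g -> (forall x, in_cube x -> `|g x| <= 1) ->
    pr P [set w | C <= `|sint mu vs g w|] <= del) ->
  let V w := boxsum K (fun n => xterm w n ^+ 2) in
  measurable [set w | 2 * C ^+ 2 <= V w] /\ pr P [set w | 2 * C ^+ 2 <= V w] <= 16 * del.
Proof.
move=> C0 hC V; pose s := index_enum {ffun 'I_d -> 'I_(2 ^ K)}.
pose X := xterms K.
have VX w : V w = \sum_(x <- X w) x ^+ 2 by rewrite big_map.
pose B := signs (size s).
pose E b := if b \in B then [set w | C <= `|sgnsum b (X w)|] else set0.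
have mE b : measurable (E b).
  rewrite /E; case: ifP => // /size_mem_signs sb.
  by have [] := sgnsum_bounded hC sb.
have pE b : b \in B -> pr P (E b) <= del.
  move=> bB; rewrite /E bB; have sb := size_mem_signs bB.
  by have [] := sgnsum_bounded hC sb.
have mW : measurable [set w | 2 * C ^+ 2 <= V w].
  apply: measurable_ge; apply: measurable_sum => t; apply: measurable_funX.
  apply: measurable_funM => //; exact: (sint_measurable smu (@simple_haar_d R d _)).
split=> //; set W := [set w | _] in mW *.
have count w : \sum_(b <- B) \1_W w <= \sum_(p <- allpairs pair B (iota 0 16)) \1_(E p.1) w :> R.
  rewrite big_allpairs_dep /=.
  have -> : \sum_(b <- B) \sum_(j <- iota 0 16) \1_(E b) w = 16 * \sum_(b <- B) \1_(E b) w :> R.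
    rewrite mulr_sumr; apply: eq_bigr => b _.
    by rewrite big_const_seq count_predT size_iota iter_addr_0 mulr_natl.
  have [Ww|nWw] := pselect (W w); last first.
    rewrite big1 ?mulr_ge0 ?sumr_ge0 // => b _; rewrite indicE ?memNset ?ler0n //.
  have V0 : 0 < \sum_(x <- X w) x ^+ 2.
    by rewrite -VX; apply: lt_le_trans Ww; rewrite mulr_gt0 ?exprn_gt0.
  have := signs_anticoncentration V0; rewrite size_map => h.
  rewrite (eq_bigr (fun=> 1)); last by move=> b _; rewrite indicE mem_set.
  rewrite sum_signs_cst mulr1; apply: le_trans h _; rewrite ler_wpM2l //.
  rewrite big_seq [leRHS]big_seq; apply: ler_sum => b bB; rewrite indicE.
  case: (leP (\sum_(x <- X w) x ^+ 2)) => [hb|_]; last by rewrite ler0n.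
  rewrite mem_set // /E bB /=; rewrite -(ler_pXn2r (n := 2)) ?nnegrE ?(ltW C0) //.
  rewrite real_normK ?num_real //; move: Ww; rewrite /W /= VX => Ww.
  by have := le_trans Ww hb; rewrite ler_pM2l.
have := sum_pr_le P (fun b : seq bool => mW) (fun p : seq bool * nat => mE p.1) count.
rewrite sum_signs_cst big_allpairs_dep /= => h.
have h' : \sum_(b <- B) \sum_(j <- iota 0 16) pr P (E b) <= \sum_(b <- B) 16 * del.
  rewrite big_seq [leRHS]big_seq; apply: ler_sum => b bB.
  rewrite big_const_seq count_predT size_iota iter_addr_0 -[leLHS]mulr_natl.
  by rewrite ler_wpM2l // pE.
have := le_trans h h'; rewrite sum_signs_cst ler_pM2l // exprn_gt0 //.
Qed.

(** The probability bound does not depend on [K], and the events [W m K] increase with [K]; by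
    continuity from below their union still has probability at most 16/(m+1), so the intersection
    over m is null. *)
Lemma haar_int_square_bounded : {ae P, forall w, exists C : R, forall K,
  boxsum K (fun n => (lamd n * haar_int mu n w) ^+ 2) <= C}.
Proof.
have hC m : exists C : R, 0 < C /\ forall vs g, simple_on_cube vs g ->
    (forall x, in_cube x -> `|g x| <= 1) ->
    pr P [set w | C <= `|sint mu vs g w|] <= m.+1%:R^-1.
  by have [|C C0 h] := sint_bounded_prob smu ug0 hxi (del := m.+1%:R^-1) _; [rewrite invr_gt0|exists C].
have [C hCm] := choice hC.
pose V K w := boxsum K (fun n => xterm w n ^+ 2).
pose W m K := [set w | 2 * C m ^+ 2 <= V K w].
have mW m K : measurable (W m K) by have [C0 h] := hCm m; have [] := square_sum_prob K C0 h.
have pW m K : pr P (W m K) <= 16 * m.+1%:R^-1.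
  by have [C0 h] := hCm m; have [] := square_sum_prob K C0 h.
pose N := \bigcap_m \bigcup_K W m K.
have mU m : measurable (\bigcup_K W m K) by exact: bigcup_measurable.
have mN : measurable N by apply: bigcapT_measurable => m; exact: mU.
have pU m : pr P (\bigcup_K W m K) <= 16 * m.+1%:R^-1.
  rewrite -lee_fin -prE //.
  have homo : {homo W m : K K' / (K <= K')%N >-> (K <= K')%O}.
    move=> K K' KK'; apply/subsetPset => w /= /le_trans; apply.
    by apply: boxsum_mono => // n; exact: sqr_ge0.
  apply: (cvge_le _ (nondecreasing_cvg_mu (mW m) (mU m) homo)).
  by apply: nearW => K /=; rewrite prE // lee_fin.
have nN : P.-negligible N.
  apply: pr_eq0_negligible => // e e0.
  pose m := Num.trunc (16 / e).
  apply: le_trans (_ : pr P (\bigcup_K W m K) <= e).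
    by apply: pr_le => //; apply: aeW => w; exact.
  apply: le_trans (pU m) _; rewrite ler_pdivrMr ?ltr0n // mulrC -ler_pdivrMr //.
  by rewrite ltW // truncnS_gt.
apply: (negligibleS _ nN) => w /= hw m _; apply: contrapT => nU; apply: hw.
exists (haar_mass ^+ 2 * (2 * C m ^+ 2)) => K.
have m0 := haar_mass_gt0.
have -> : boxsum K (fun n => (lamd n * haar_int mu n w) ^+ 2) = haar_mass ^+ 2 * V K w.
  rewrite /V /boxsum mulr_sumr; apply: eq_bigr => t _; rewrite /xterm.
  by field; rewrite gt_eqF.
rewrite ler_wpM2l ?sqr_ge0 // leNgt; apply/negP => h; apply: nU; exists K => //=.
exact: ltW.
Qed.

End SquareSums.

(** * Uniform convergence of the series *)

Section Assembly.
Context {R : realType}.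

(** Cauchy-Schwarz in the form of Young's inequality, without square roots: the tail of [B] is
    small, the sum of [X2] is only bounded, and [tau] balances them. *)
Lemma boxsum_dist (d : nat) K K' (F B X2 : ('I_d -> nat) -> R) (tau C : R) :
  (K <= K')%N -> 0 <= tau -> (forall n, 0 <= X2 n) ->
  (forall n, (forall i, 0 < n i)%N -> 2 * `|F n| <= tau * B n + tau^-1 * X2 n) ->
  boxsum K' X2 <= C ->
  2 * `|boxsum K' F - boxsum K F| <= tau * (boxsum K' B - boxsum K B) + tau^-1 * C.
Proof.
move=> KK' tau0 X0 hF hC; rewrite !(boxsum_widen _ KK').
pose small (t : {ffun 'I_d -> 'I_(2 ^ K')}) := [forall s, (t s < 2 ^ K)%N].
have split G : boxsum K' G - \sum_(t | small t) G (fun s => (t s).+1) =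
    \sum_(t : {ffun 'I_d -> 'I_(2 ^ K')} | ~~ small t) G (fun s => (t s).+1).
  by rewrite /boxsum (bigID small) /= addrAC subrr add0r.
rewrite !split; apply: le_trans (ler_wpM2l _ (ler_norm_sum _ _ _)) _ => //.
rewrite mulr_sumr; pose n (t : {ffun 'I_d -> 'I_(2 ^ K')}) s := (t s).+1.
apply: (@le_trans _ _ (\sum_(t | ~~ small t) (tau * B (n t) + tau^-1 * X2 (n t)))).
  by apply: ler_sum => t _; exact: hF.
rewrite big_split /= -!mulr_sumr lerD2l ler_wpM2l ?invr_ge0 //.
apply: le_trans hC; rewrite /boxsum [leRHS](bigID small) /= lerDr.
exact: sumr_ge0.
Qed.

Lemma eta_partialE {d : nat} {dO : measure_display} {Omega : measurableType dO}
  (mu : set (pt R d) -> Omega -> R) g K w :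
  eta_partial mu g K w = int_haar_psum mu K g w.
Proof.
elim: K => [|K IH]; first by rewrite /eta_partial big_geq // addr0.
by rewrite /eta_partial big_nat_recr //= addrA -/(eta_partial mu g K w) IH addrC subrK.
Qed.

(** Level j has 2^j indices, so the sum over levels is geometric with ratio 2 (theta / rho)^2 <
    1. *)
Lemma sum_weighted_lev (theta rho : R) K : 0 < rho -> 2 * theta ^+ 2 < rho ^+ 2 ->
  \sum_(0 <= n < 2 ^ K) ((theta / rho) ^+ 2) ^+ lev n.+1 <= 1 + (1 - 2 * (theta / rho) ^+ 2)^-1.
Proof.
move=> rho0 tr; set q := (theta / rho) ^+ 2.
have q0 : 0 <= 2 * q by rewrite mulr_ge0 ?sqr_ge0.
have q1 : 2 * q < 1.
  by rewrite /q expr_div_n mulrA ltr_pdivrMr ?exprn_gt0 // mul1r.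
rewrite (sum_lev (fun n => q ^+ lev n)) lev1 expr0 lerD2l.
apply: le_trans (sum_geom_le K (_ : 0 <= 2 * q < 1)); last by rewrite q0.
apply: ler_sum => j _; rewrite big_nat (eq_bigr (fun=> q ^+ j)).
  by rewrite -big_nat sumr_const_nat subn0 [leRHS]exprMn -[leLHS]mulr_natl natrX.
by move=> i /andP[_ ij]; rewrite levD.
Qed.

Lemma nondecreasing_tail (H : nat -> R) (M e : R) :
  (forall K K', (K <= K')%N -> H K <= H K') -> (forall K, H K <= M) -> 0 < e ->
  exists K0, forall K K', (K0 <= K)%N -> (K <= K')%N -> H K' - H K <= e.
Proof.
move=> homo hM e0.
have cv : cvgn H.
  by apply: nondecreasing_is_cvgn => //; exists M => _ [K _ <-].
have /cvgrPdist_le /(_ _ e0)[K0 _ h] : H @ \oo --> limn H by []; exists K0 => K K' K0K KK'.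
have := h K K0K => /= /(le_trans (ler_norm _)); apply: le_trans.
by rewrite lerD2r; apply: nondecreasing_cvgn_le.
Qed.

Lemma unif_cauchy_limit (Z : topologicalType) (A : nat -> Z -> R) :
  (forall e : R, 0 < e -> exists K0, forall z K K', (K0 <= K)%N -> (K <= K')%N ->
     `|A K' z - A K z| <= e) ->
  (forall K, continuous (A K)) ->
  (forall z, cvg ((fun K => A K z) @ \oo)) /\ continuous (fun z => lim ((fun K => A K z) @ \oo)).
Proof.
move=> ca cA.
have cv z : cvg ((fun K => A K z) @ \oo).
  apply: cauchy_cvg; apply: cauchy_exP => e e0.
  have [K0 hK0] := ca _ (divr_gt0 e0 (ltr0n R 2)); exists (A K0 z).
  exists K0 => // K /= K0K; rewrite /ball /= distrC; apply: le_lt_trans (hK0 z _ _ (leqnn _) K0K) _.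
  lra.
split=> // z0; apply/cvgrPdist_lt => e e0.
have e40 : 0 < e / 4 by rewrite divr_gt0.
have [K hK] := ca _ e40.
have hL z : `|lim ((fun K => A K z) @ \oo) - A K z| <= e / 4.
  rewrite distrC; have cn : (fun K' => `|A K z - A K' z|) @ \oo -->
      `|A K z - lim ((fun K => A K z) @ \oo)|.
    by apply: cvg_norm; apply: cvgB; [exact: cvg_cst|exact: cv].
  by apply: (cvgr_to_le cn); exists K => // K' /= KK'; rewrite distrC; apply: hK.
have /cvgrPdist_lt /(_ _ e40) := cA K z0; apply: filterS => z h /=.
have h1 := hL z0; have h2 := hL z.
move: h h1 h2; set a := A K z0; set b := A K z; set L := lim _; set L' := lim _ => h h1 h2.
have -> : L - L' = (L - a) + (a - b) - (L' - b) by ring.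
apply: le_lt_trans (ler_normB _ _) _; apply: le_lt_trans (lerD (ler_normD _ _) (lexx _)) _.
lra.
Qed.

End Assembly.

(** * Uniform convergence of the series and identification of its limit *)

Theorem theorem2 (R : realType) (Z : metricType R)
  (dO : measure_display) (Omega : measurableType dO) (P : probability Omega R)
  (d : nat) (l : nat) (alpha : R) (f : Z -> pt R d -> R)
  (mu : set (pt R d) -> Omega -> R) (eta : Z -> Omega -> R) :
  (1 <= d)%N -> 0 < alpha ->
  (forall x, in_cube x -> continuous (fun z => f z x)) ->
  (exists2 Cf : R, 0 < Cf &
     exists D : seq 'I_d -> Z -> pt R d -> R,
     [/\ forall z x, in_cube x -> D [::] z x = f z x,
         forall z ks s x, (size ks < l)%N -> in_cube x ->
           partial_within (D ks z) s x (D (s :: ks) z x),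
         forall z ks, (size ks <= l)%N -> cont_on_cube (D ks z),
         forall z ks x, (size ks <= l)%N -> in_cube x -> `|D ks z x| <= Cf
       & forall z ks x1 x2, size ks = l -> in_cube x1 -> in_cube x2 ->
           `|D ks z x1 - D ks z x2| <= Cf * eucl_dist x1 x2 `^ alpha]) ->
  stoch_measure P mu ->
  (forall z, stoch_integral P mu (f z) (eta z)) ->
  d%:R / 2 < l%:R + alpha ->
  (forall z, {ae P, forall w,
     cvg ((fun K => eta_partial mu (f z) K w) @ \oo) /\
     lim ((fun K => eta_partial mu (f z) K w) @ \oo) = eta z w}) /\
  {ae P, forall w,
     (forall z, cvg ((fun K => eta_partial mu (f z) K w) @ \oo)) /\
     continuous (fun z => lim ((fun K => eta_partial mu (f z) K w) @ \oo))}.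
Proof.
move=> d0 alpha0 fcont [Cf Cf0 [D [D0 Dder Dcont Dbd Dhold]]] smu hint hl.
have ef : equi_modulus f.
  move=> e e0; have dR : 0 < d%:R :> R by rewrite ltr0n.
  have ed0 : 0 < e / d%:R by rewrite divr_gt0.
  exists (osc_radius l alpha Cf (e / d%:R)); first exact: osc_radius_gt0.
  move=> z x y xc yc xy; have := coord_telescope _ xc yc xy (e := e / d%:R).
  rewrite mulrCA mulfV ?gt_eqF // mulr1; apply=> k x' u v kd x'c u01 v01 uv.
  exact: (coord_osc (G := fun ks => D ks z) alpha0 Cf0 (D0 z) (Dder z) (Dcont z) (Dbd z) (Dhold z)).
suff main : {ae P, forall w,
     (forall z, cvg ((fun K => eta_partial mu (f z) K w) @ \oo)) /\
     continuous (fun z => lim ((fun K => eta_partial mu (f z) K w) @ \oo))}.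
  split=> // z; have [me hz] := hint z.
  have [vs hvs] := choice (fun K => haar_psum_simple smu K (f z)).
  have cX : conv_prob P (fun K => sint mu (vs K) (haar_psum K (f z))) (eta z).
    by apply: hz => [K|e e0]; [have [] := hvs K|exact: haar_psum_unif (equi_unif_cont z ef) e0].
  have aeX : {ae P, forall w, forall K, sint mu (vs K) (haar_psum K (f z)) w = eta_partial mu (f z) K w}.
    apply: ae_foralln => K; have [_] := hvs K; apply: filterS => w ->.
    by rewrite eta_partialE.
  have cvX : {ae P, forall w, (fun K => sint mu (vs K) (haar_psum K (f z)) w) @ \oo -->
      lim ((fun K => eta_partial mu (f z) K w) @ \oo)}.
    apply: filterS2 main aeX => w [/(_ z) cv _] e.
    by rewrite (funext e).
  have := conv_prob_ae_unique _ me cX cvX.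
  move=> /(_ (fun K => sint_measurable smu (hvs K).1)).
  by apply: filterS2 main => w [/(_ z) cv _].
(* The boundedness of [mu] is extracted from the integral of a single [f z0], so a point is
   required; for empty [Z] the claim is void. *)
have [[z0 _]|noZ] := pselect (exists z : Z, True); last first.
  apply: aeW => w; split=> [z|z]; exfalso; apply: noZ; by exists z.
pose th := theta d l alpha; pose kap := Num.sqrt 2 * th.
have th0 : 0 < th by rewrite powR_gt0.
have kap0 : 0 < kap by rewrite mulr_gt0 ?sqrt2_gt0.
have b12 : 2^-1 < beta d l alpha.
  rewrite /beta lt_min; apply/andP; split; first by lra.
  by rewrite ltr_pdivlMr ?ltr0n // mulrC.
have kap1 : kap < 1.
  rewrite /kap -powR12_sqrt // /th /theta -powRD ?pnatr_eq0 ?implybT //.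
  by rewrite /powR pnatr_eq0 /= expR_lt1 pmulr_llt0 ?ln_gt0 ?ltr1n // subr_lt0.
(* The midpoint of [kap] and 1: below 1 for the weights, above [kap] for the squared
   coefficients. *)
pose rho := (1 + kap) / 2.
have rho0 : 0 < rho by rewrite /rho; lra.
have rho01 : 0 <= rho < 1 by rewrite /rho; apply/andP; split; lra.
have thrho : 2 * th ^+ 2 < rho ^+ 2.
  have -> : 2 * th ^+ 2 = kap ^+ 2 by rewrite /kap exprMn sqr_sqrtr.
  by rewrite ltr_pXn2r ?nnegrE ?ltW //; rewrite /rho; lra.
(* A majorant, free of [z], of the squared quotient of [haar_coef n (f z)] by [lamd rho n]; the
   powers of sqrt 2 cancel. *)
pose B (n : 'I_d -> nat) : R := Cf ^+ 2 * \prod_(s < d) ((th / rho) ^+ 2) ^+ lev (n s).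
have B0 n : 0 <= B n.
  by rewrite mulr_ge0 ?sqr_ge0 //; apply: prodr_ge0 => s _; rewrite exprn_ge0 ?sqr_ge0.
pose M : R := Cf ^+ 2 * (1 + (1 - 2 * (th / rho) ^+ 2)^-1) ^+ d.
have BM K : boxsum K B <= M.
  rewrite /boxsum -mulr_sumr ler_wpM2l ?sqr_ge0 //.
  rewrite -/(boxsum K (fun n : 'I_d -> nat => \prod_(s < d) ((th / rho) ^+ 2) ^+ lev (n s))).
  rewrite (boxsum_prod K (fun s m => ((th / rho) ^+ 2) ^+ lev m)).
  rewrite -[X in _ <= _ ^+ X]card_ord -prodr_const; apply: ler_prod => s _.
  rewrite sum_weighted_lev // andbT; apply: sumr_ge0 => m _.
  by rewrite exprn_ge0 ?sqr_ge0.
have lamd0 (n : 'I_d -> nat) : 0 < lamd rho n.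
  apply: prodr_gt0 => s _; rewrite mulr_gt0 ?exprn_gt0 ?invr_gt0 ?sqrt2_gt0 //.
have coefB z n : (forall i, 0 < n i)%N -> haar_coef n (f z) ^+ 2 <= B n * lamd rho n ^+ 2.
  move=> n0; have := haar_coef_decay (G := fun ks => D ks z) d0 alpha0 Cf0 (D0 z) (Dder z)
    (Dcont z) (Dbd z) (Dhold z) n0 (equi_unif_cont z ef).
  rewrite -/th => h; rewrite -real_normK ?num_real //.
  have -> : B n * lamd rho n ^+ 2 = (Cf * \prod_(i < d) ((Num.sqrt 2)^-1 ^+ lev (n i) * th ^+ lev (n i))) ^+ 2.
    rewrite [RHS]exprMn /B /lamd -mulrA; congr (_ * _); rewrite -!prodrXl -big_split /=.
    apply: eq_bigr => s _; rewrite /lam exprAC -!exprMn mulrC -mulrA.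
    by rewrite [rho * _]mulrC divfK ?gt_eqF.
  by rewrite lerXn2r ?nnegrE ?normr_ge0 // (le_trans _ h).
apply: filterS (haar_int_square_bounded smu (equi_unif_cont z0 ef) (hint z0) rho01) => w [C hC].
have E z : (fun K => eta_partial mu (f z) K w) = (fun K => int_haar_psum mu K (f z) w).
  by apply/funext => K; rewrite eta_partialE.
suff [c1 c2] : (forall z, cvg ((fun K => int_haar_psum mu K (f z) w) @ \oo)) /\
    continuous (fun z => lim ((fun K => int_haar_psum mu K (f z) w) @ \oo)).
  split=> [z|]; first by rewrite E; exact: c1.
  by rewrite (funext (fun z => congr1 (fun u : nat -> R => lim (u @ \oo)) (E z))).
apply: (unif_cauchy_limit (A := fun K z => int_haar_psum mu K (f z) w)).
  move=> e e0; pose C1 := `|C| + 1; have C10 : 0 < C1 by rewrite ltr_wpDl.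
  have eC0 : 0 < e ^+ 2 / C1 by rewrite divr_gt0 ?exprn_gt0.
  have [K0 hK0] := nondecreasing_tail (fun K K' KK' => boxsum_mono KK' B0) BM eC0.
  (* With the tail of [B] at most e^2 / C1, this choice makes both terms of the bound equal to e,
     which matches the factor 2 on the left. *)
  exists K0 => z K K' K0K KK'; pose tau := C1 / e; have tau0 : 0 < tau by rewrite divr_gt0.
  pose X2 n : R := (lamd rho n * haar_int mu n w) ^+ 2.
  have X20 n : 0 <= X2 n by exact: sqr_ge0.
  have hF n : (forall i, 0 < n i)%N ->
      2 * `|haar_coef n (f z) * haar_int mu n w| <= tau * B n + tau^-1 * X2 n.
    move=> n0; have := coefB z n n0; rewrite /X2 exprMn normrM.
    rewrite -[haar_coef _ _ ^+ 2]real_normK ?num_real // -[haar_int _ _ _ ^+ 2]real_normK ?num_real //.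
    move: `|haar_coef _ _| (normr_ge0 (haar_coef n (f z))) `|haar_int _ _ _| (normr_ge0 (haar_int mu n w)).
    move: (lamd rho n) (lamd0 n) (B n) => L L0 b c c0 x x0 hb.
    have hb' : c ^+ 2 / L ^+ 2 <= b by rewrite ler_pdivrMr ?exprn_gt0.
    apply: le_trans (_ : tau * (c ^+ 2 / L ^+ 2) + tau^-1 * (L ^+ 2 * x ^+ 2) <= _); last first.
      by rewrite lerD2r ler_wpM2l // ltW.
    have : 0 <= tau^-1 * (tau * (c / L) - L * x) ^+ 2 by rewrite mulr_ge0 ?sqr_ge0 // invr_ge0 ltW.
    have -> : tau^-1 * (tau * (c / L) - L * x) ^+ 2 =
      tau * (c ^+ 2 / L ^+ 2) + tau^-1 * (L ^+ 2 * x ^+ 2) - 2 * (c * x).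
      by field; rewrite !gt_eqF.
    by rewrite subr_ge0.
  have := boxsum_dist KK' (ltW tau0) X20 hF (hC K'); rewrite -/(int_haar_psum _ _ _ _).
  move=> h; rewrite -(ler_pM2l (ltr0n R 2)); apply: le_trans h _.
  have h1 := hK0 K K' K0K KK'.
  apply: le_trans (_ : tau * (e ^+ 2 / C1) + tau^-1 * C1 <= _).
    rewrite lerD // ler_wpM2l ?invr_ge0 ?(ltW tau0) //.
    by rewrite /C1 (le_trans (ler_norm C)) // lerDl.
  by rewrite le_eqVlt; apply/orP; left; apply/eqP; rewrite /tau; field; rewrite !gt_eqF.
move=> K z1; apply/cvgrPdist_lt => e e0.
pose S : R := \sum_(t : {ffun 'I_d -> 'I_(2 ^ K)}) `|haar_int mu (fun s => (t s).+1) w|.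
have S0 : 0 <= S by apply: sumr_ge0.
have e10 : 0 < e / (S + 1) by rewrite divr_gt0 // ltr_wpDl.
apply: filterS (equi_near z1 ef fcont e10) => z hz.
rewrite /int_haar_psum -sumrB; apply: le_lt_trans (ler_norm_sum _ _ _) _.
apply: le_lt_trans (_ : e / (S + 1) * S < e); last first.
  by rewrite mulrAC ltr_pdivrMr ?ltr_wpDl // mulrDr mulr1 ltrDl.
rewrite /S mulr_sumr; apply: ler_sum => t _; rewrite -mulrBl normrM ler_wpM2r // distrC.
by apply: haar_coef_dist; [by []|exact: equi_unif_cont|exact: equi_unif_cont|].
Qed.
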